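(* Define on small subsets of $\mathcal U_+$ the relation $A\perp\!\!\!\perp^+_C B\iff \operatorname{acl}_+(AC)\perp\!\!\!\perp^0_{\operatorname{acl}_+(C)}\operatorname{acl}_+(BC)$. Then: (1) $\perp\!\!\!\perp^+$ is invariant (under automorphisms of $\mathcal U_+$) and normal; (2) if $\perp\!\!\!\perp^0$ satisfies any of monotonicity, symmetry, finite character, then so does $\perp\!\!\!\perp^+$; (3) if $\perp\!\!\!\perp^0$ is transitive and monotone, then $\perp\!\!\!\perp^+$ is transitive; (4) if $\perp\!\!\!\perp^0$ satisfies base monotonicity, finite character and local character, then $\perp\!\!\!\perp^+$ has local character; (5) if $\perp\!\!\!\perp^0$ satisfies normality, monotonicity, base monotonicity, transitivity, symmetry and full existence, then $\perp\!\!\!\perp^+$ satisfies base monotonicity; (6) if $\perp\!\!\!\perp^0$ satisfies monotonicity, symmetry and full existence, then $\perp\!\!\!\perp^+$ satisfies full existence; (7) if $\perp\!\!\!\perp^0$ satisfies monotonicity and extension and $T_+$ has quantifier elimination, then $\perp\!\!\!\perp^+$ satisfies extension. In addition, if $T_0\subseteq T_+$, then (2), (3) and (7) also hold for the corresponding properties stated over models.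
   Context: Theories are closed under deduction. $\mathcal L_0\subseteq\mathcal L$ are first-order (possibly many-sorted) languages. $T_0$ is a complete, model complete $\mathcal L_0$-theory with monster model $\mathcal U_0$, and $\perp\!\!\!\perp^0$ is an automorphism-invariant ternary relation on small subsets of $\mathcal U_0$; $\operatorname{acl}_0$ is algebraic closure in $\mathcal U_0$ in $\mathcal L_0$. $T$ is an $\mathcal L$-theory with $T_0^\forall\subseteq T$. $M\leq_{\mathcal L}N$ means $M$ is an $\mathcal L$-substructure of $N$; $\langle X\rangle_{\mathcal L}$ is the generated $\mathcal L$-substructure. Definition: $T$ is derivation-like with respect to $(T_0,\perp\!\!\!\perp^0)$ if whenever $A,B,C\models T^\forall$ with $C$ a common $\mathcal L$-substructure of $A$ and $B$, $A,B\leq_{\mathcal L_0}\mathcal U_0$, $\operatorname{acl}_0(C)\cap A=\operatorname{acl}_0(C)\cap B=C$, and $A\perp\!\!\!\perp^0_C B$, then (i) there is $M\models T$ with $M\leq_{\mathcal L_0}\mathcal U_0$ and $A,B\leq_{\mathcal L}M$; and (ii) for every such $M$ and every $\mathcal L_0$-structure $D$ with $\langle A,B\rangle_{\mathcal L_0}\leq_{\mathcal L_0}D\leq_{\mathcal L_0}\operatorname{acl}_0(A,B)\cap M$, we have $D\leq_{\mathcal L}M$, and this $\mathcal L$-structure on $D$ is the unique one expanding its $\mathcal L_0$-structure, making it a model of $T^\forall$, and extending the $\mathcal L$-structures of $A$ and $B$. Standing assumptions: $T$ is derivation-like with respect to $(T_0,\perp\!\!\!\perp^0)$; $T$ has a model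 companion $T_+$ with $T\subseteq T_+$; $\mathcal U_+$ is a monster model of a completion of $T_+$ with $\mathcal U_+\leq_{\mathcal L_0}\mathcal U_0$; $\operatorname{acl}_+$ is algebraic closure in $\mathcal U_+$ in $\mathcal L$; $T_0$ has quantifier elimination in $\mathcal L_0$ (a standing assumption of the paper). Properties of a ternary relation $\perp\!\!\!\perp$ on small subsets of a monster model (types taken in the relevant theory): normality: $A\perp\!\!\!\perp_C B\Rightarrow A\perp\!\!\!\perp_C BC$; monotonicity: $A\perp\!\!\!\perp_C BD\Rightarrow A\perp\!\!\!\perp_C B$; base monotonicity: $A\perp\!\!\!\perp_C BD\Rightarrow A\perp\!\!\!\perp_{CD}B$; transitivity: $A\perp\!\!\!\perp_C B$ and $A\perp\!\!\!\perp_B D$ imply $A\perp\!\!\!\perp_C D$ whenever $C\subseteq B\subseteq D$; symmetry: $A\perp\!\!\!\perp_C B\Rightarrow B\perp\!\!\!\perp_C A$; full existence: for all $A,B,C$ there is $A'\equiv_C A$ with $A'\perp\!\!\!\perp_C B$; finite character: if $A_0\perp\!\!\!\perp_C B$ for all finite $A_0\subseteq A$ then $A\perp\!\!\!\perp_C B$; local character: for every $A$ there is a cardinal $\kappa$ such that for every $B$ there is $C\subseteq B$ with $|C|<\kappa$ and $A\perp\!\!\!\perp_C B$; extension: if $A\perp\!\!\!\perp_C B$ then for every $D$ there is $A'\equiv_{BC}A$ with $A'\perp\!\!\!\perp_C BD$. A property ''holds over models'' if it holds whenever the base $C$ is a small model of the theory (for transitivity: whenever $C$ and $B$ are small models).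
   Formalization: In (2) for finite character and in (3), and in their versions over models, the base relation is also assumed left monotone (AD independent from B over C implies A independent from B over C); with right monotonicity and one-directional finite character only, these claims fail. *)

(* Defs.v *)
From mathcomp Require Import all_boot.
From mathcomp Require Import boolp classical_sets functions cardinality.

Set Implicit Arguments.
Unset Strict Implicit.
Unset Printing Implicit Defensive.

Local Open Scope classical_set_scope.
Local Open Scope card_scope.

(** * Many-sorted first-order logic

    Variables live in explicit finite contexts (lists of sorts), so the
    semantics is correct when some or all sorts of a structure are empty:
    empty structures are allowed. *)

Inductive var (S : Type) : seq S -> S -> Type :=
| vz s G : var (s :: G) s
| vs s G t : var G t -> var (s :: G) t.

(** Sorted tuples; used both for arguments of symbols and for valuations. *)
Definition tup (S : Type) (X : S -> Type) (G : seq S) : Type :=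
  forall s, var G s -> X s.

Definition tcons (S : Type) (X : S -> Type) (s : S) (G : seq S)
    (x : X s) (a : tup X G) : tup X (s :: G) :=
  fun t v =>
    match v in var D u return
      match D with
      | [::] => Datatypes.unit
      | r :: D' => X r -> tup X D' -> X u
      end
    with
    | vz r D' => fun y _ => y
    | vs r D' u w => fun _ b => b u w
    end x a.

Definition tmap (S : Type) (X Y : S -> Type) (h : forall s, X s -> Y s)
    (G : seq S) (a : tup X G) : tup Y G :=
  fun s v => h s (a s v).

Record language (S : Type) := Language {
  fsym : Type;
  fdom : fsym -> seq S;
  fcod : fsym -> S;
  rsym : Type;
  rdom : rsym -> seq S
}.

(** [L0] included in [L], with the same sorts. *)
Record sublanguage (S : Type) (L : language S) := Sublanguage {
  sub_fsym : set (fsym L);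
  sub_rsym : set (rsym L)
}.

Definition lang_of (S : Type) (L : language S) (L0 : sublanguage L)
    : language S :=
  {| fsym := {f : fsym L | sub_fsym L0 f};
     fdom := fun f => fdom (proj1_sig f);
     fcod := fun f => fcod (proj1_sig f);
     rsym := {r : rsym L | sub_rsym L0 r};
     rdom := fun r => rdom (proj1_sig r) |}.
Coercion lang_of : sublanguage >-> language.

Inductive term (S : Type) (L : language S) (G : seq S) : S -> Type :=
| Var s : var G s -> term L G s
| App (f : fsym L) : (forall s, var (fdom f) s -> term L G s) ->
    term L G (fcod f).

Inductive formula (S : Type) (L : language S) : seq S -> Type :=
| FFalse G : formula L G
| FEq G s : term L G s -> term L G s -> formula L G
| FRel G (r : rsym L) : tup (term L G) (rdom r) -> formula L G
| FImp G : formula L G -> formula L G -> formula L G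
| FAll G s : formula L (s :: G) -> formula L G.

Arguments FFalse {S L G}.

Definition FNot (S : Type) (L : language S) (G : seq S) (p : formula L G) :=
  FImp p FFalse.

Definition sentence (S : Type) (L : language S) := formula L [::].
Definition theory (S : Type) (L : language S) := set (sentence L).

(** The cardinal |L| is by convention that of the set of all L-formulas. *)
Definition any_formula (S : Type) (L : language S) : Type :=
  {G : seq S & formula L G}.

Fixpoint qfree (S : Type) (L : language S) (G : seq S) (p : formula L G)
    : Prop :=
  match p with
  | FFalse _ | FEq _ _ _ _ | FRel _ _ _ => True
  | FImp _ q r => qfree q /\ qfree r
  | FAll _ _ _ => False
  end.

Inductive universal (S : Type) (L : language S)
    : forall G : seq S, formula L G -> Prop :=
| univ_qf G (p : formula L G) : qfree p -> universal p
| univ_all G s (p : formula L (s :: G)) : universal p -> universal (FAll p).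

Fixpoint lift_term (S : Type) (L : language S) (L0 : sublanguage L)
    (G : seq S) (s : S) (t : term L0 G s) : term L G s :=
  match t with
  | Var _ v => Var L v
  | App f a => @App S L G (proj1_sig f) (fun u v => lift_term (a u v))
  end.

Fixpoint lift_formula (S : Type) (L : language S) (L0 : sublanguage L)
    (G : seq S) (p : formula L0 G) : formula L G :=
  match p with
  | FFalse _ => FFalse
  | FEq _ _ t u => FEq (lift_term t) (lift_term u)
  | FRel _ r a => @FRel S L _ (proj1_sig r) (fun u v => lift_term (a u v))
  | FImp _ q r => FImp (lift_formula q) (lift_formula r)
  | FAll _ _ q => FAll (lift_formula q)
  end.

Definition subtheory (S : Type) (L : language S) (L0 : sublanguage L)
    (T0 : theory L0) (T : theory L) : Prop :=
  forall p : sentence L0, T0 p -> T (lift_formula p).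

(** * Structures *)

Record interp (S : Type) (L : language S) (X : S -> Type) := Interp {
  ifn : forall f : fsym L, tup X (fdom f) -> X (fcod f);
  irel : forall r : rsym L, tup X (rdom r) -> Prop
}.

Record structure (S : Type) (L : language S) := Structure {
  carrier : S -> Type;
  inter : interp L carrier
}.
Coercion carrier : structure >-> Funclass.

Fixpoint eval (S : Type) (L : language S) (M : structure L) (G : seq S)
    (a : tup M G) (s : S) (t : term L G s) : M s :=
  match t with
  | Var _ v => a _ v
  | App f b => ifn (inter M) (fun u v => eval a (b u v))
  end.

Fixpoint sat (S : Type) (L : language S) (M : structure L) (G : seq S)
    (p : formula L G) : tup M G -> Prop :=
  match p with
  | FFalse _ => fun _ => False
  | FEq _ _ t u => fun a => eval a t = eval a u
  | FRel _ r b => fun a => irel (inter M) (fun u v => eval a (b u v))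
  | FImp _ q r => fun a => sat q a -> sat r a
  | FAll _ s q => fun a => forall x : M s, sat q (tcons x a)
  end.

Definition tnil (S : Type) (X : S -> Type) : tup X [::] :=
  fun s v =>
    match v in var D u return
      match D with [::] => X u | _ :: _ => Datatypes.unit end
    with
    | vz _ _ => tt
    | vs _ _ _ _ => tt
    end.

Definition models (S : Type) (L : language S) (M : structure L)
    (T : theory L) : Prop :=
  forall p, T p -> sat p (@tnil S M).

Definition entails (S : Type) (L : language S) (T : theory L)
    (p : sentence L) : Prop :=
  forall M : structure L, models M T -> sat p (@tnil S M).

Definition deductively_closed (S : Type) (L : language S) (T : theory L) :=
  forall p, entails T p -> T p.

(** The universal part of [T]. *)
Definition univ_part (S : Type) (L : language S) (T : theory L) : theory L :=
  [set p | universal p /\ entails T p].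

Definition complete (S : Type) (L : language S) (T : theory L) : Prop :=
  (exists M : structure L, models M T) /\
  forall p : sentence L, T p \/ T (FNot p).

Definition quantifier_elimination (S : Type) (L : language S)
    (T : theory L) : Prop :=
  forall (G : seq S) (p : formula L G), exists q : formula L G,
    qfree q /\
    forall M : structure L, models M T -> forall a : tup M G,
      sat p a <-> sat q a.

Definition embedding (S : Type) (L : language S) (M N : structure L)
    (h : forall s, M s -> N s) : Prop :=
  [/\ forall s, injective (h s),
      forall f (a : tup M (fdom f)),
        h _ (ifn (inter M) a) = ifn (inter N) (tmap h a)
    & forall r (a : tup M (rdom r)),
        irel (inter M) a <-> irel (inter N) (tmap h a)].

Definition automorphism (S : Type) (L : language S) (M : structure L)
    (h : forall s, M s -> M s) : Prop :=
  embedding h /\ forall s (y : M s), exists x, h s x = y.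

(** Subsets of a many-sorted structure are sets of sorted elements. *)
Definition elt (S : Type) (X : S -> Type) : Type := {s : S & X s}.

Definition emap (S : Type) (X Y : S -> Type) (h : forall s, X s -> Y s)
    (e : elt X) : elt Y :=
  existT Y (projT1 e) (h (projT1 e) (projT2 e)).

Definition tup_in (S : Type) (X : S -> Type) (D : set (elt X)) (G : seq S)
    (a : tup X G) : Prop :=
  forall s v, D (existT X s (a s v)).

(** [h] restricted to [D] is a partial elementary map. *)
Definition elementary_on (S : Type) (L : language S) (M N : structure L)
    (D : set (elt M)) (h : forall s, M s -> N s) : Prop :=
  forall G (p : formula L G) (a : tup M G),
    tup_in D a -> (sat p a <-> sat p (tmap h a)).

Definition model_complete (S : Type) (L : language S) (T : theory L) :=
  forall (M N : structure L) (h : forall s, M s -> N s),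
    models M T -> models N T -> embedding h -> elementary_on setT h.

Definition model_companion (S : Type) (L : language S) (T Tp : theory L) :=
  [/\ model_complete Tp,
      forall M : structure L, models M T ->
        exists (N : structure L) (h : forall s, M s -> N s),
          models N Tp /\ embedding h
    & forall M : structure L, models M Tp ->
        exists (N : structure L) (h : forall s, M s -> N s),
          models N T /\ embedding h].

(** * Structures whose underlying set is a subset of a given one *)

Definition subsort (S : Type) (X : S -> Type) (D : set (elt X)) : S -> Type :=
  fun s => {x : X s | D (existT X s x)}.

Record structure_in (S : Type) (L : language S) (X : S -> Type) :=
  StructureIn {
    dom : set (elt X);
    dom_interp : interp L (subsort dom)
  }.

Definition struct_of (S : Type) (L : language S) (X : S -> Type)
    (A : structure_in L X) : structure L := Structure (dom_interp A).
Coercion struct_of : structure_in >-> structure.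

Definition incl (S : Type) (L : language S) (X : S -> Type)
    (A : structure_in L X) (s : S) (x : A s) : X s := proj1_sig x.

(** [A] is a substructure of [B]. *)
Definition substr (S : Type) (L : language S) (X : S -> Type)
    (A B : structure_in L X) : Prop :=
  exists i : forall s, A s -> B s,
    (forall s (x : A s), incl (i s x) = incl x) /\ embedding i.

(** [A] is a substructure of the ambient structure [U]. *)
Definition substr_of (S : Type) (L : language S) (U : structure L)
    (A : structure_in L U) : Prop :=
  @embedding S L A U (@incl S L U A).

Definition reduct_interp (S : Type) (L : language S) (L0 : sublanguage L)
    (X : S -> Type) (I : interp L X) : interp L0 X :=
  @Interp S L0 X (fun f a => ifn I (f := proj1_sig f) a)
                 (fun r a => irel I (r := proj1_sig r) a).

Definition reduct (S : Type) (L : language S) (L0 : sublanguage L)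
    (X : S -> Type) (A : structure_in L X) : structure_in L0 X :=
  StructureIn (reduct_interp L0 (dom_interp A)).

Definition generated (S : Type) (L : language S) (M : structure L)
    (A : set (elt M)) : set (elt M) :=
  [set e | forall Y : set (elt M), A `<=` Y ->
     (forall f (a : tup M (fdom f)), tup_in Y a ->
        Y (existT M (fcod f) (ifn (inter M) a))) ->
     Y e].

(** [C] is (the underlying set of) a substructure of [U] which models [T]. *)
Definition submodel (S : Type) (L : language S) (U : structure L)
    (T : theory L) (C : set (elt U)) : Prop :=
  exists N : structure_in L U, [/\ substr_of N, dom N = C & models N T].

Definition acl (S : Type) (L : language S) (M : structure L)
    (C : set (elt M)) : set (elt M) :=
  [set e | exists (G : seq S) (p : formula L (projT1 e :: G)) (c : tup M G),
     [/\ tup_in C c, sat p (tcons (projT2 e) c)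
       & finite_set [set y : M (projT1 e) | sat p (tcons y c)]]].

(** [A'] and [A] have the same type over [C] (for some enumerations). *)
Definition same_type (S : Type) (L : language S) (M : structure L)
    (C A' A : set (elt M)) : Prop :=
  exists h : forall s, M s -> M s,
    [/\ elementary_on (A `|` C) h,
        forall c, C c -> emap h c = c
      & emap h @` A = A'].

(** * Monster models

    Throughout, [K] is a type whose cardinal plays the role of kappa. *)

Definition card_lt (X Y : Type) (A : set X) (B : set Y) : Prop :=
  ~~ (B #<= A).

Definition small (K X : Type) (A : set X) : Prop := card_lt A [set: K].

(** "Sufficiently large" is taken to mean: a limit cardinal of cofinality
    greater than 2^|L| (for instance, any strongly inaccessible cardinal
    greater than |L|). *)
Definition large_cardinal (K S : Type) (L : language S) : Prop :=
  [/\ small K [set: set (any_formula L)],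
      forall A : set K, small K A -> exists B : set K, small K B /\ card_lt A B
    & forall F : set (any_formula L) -> set K,
        (forall i, small K (F i)) ->
        exists B : set K, small K B /\ forall i, F i #<= B].

(** A formula in one free variable of sort [s], with its parameters. *)
Definition pformula (S : Type) (L : language S) (M : structure L) (s : S) :=
  {G : seq S & (formula L (s :: G) * tup M G)%type}.

Definition realizes (S : Type) (L : language S) (M : structure L) (s : S)
    (x : M s) (p : set (pformula M s)) : Prop :=
  forall q, p q -> sat (projT2 q).1 (tcons x (projT2 q).2).

Definition saturated (K S : Type) (L : language S) (M : structure L) :=
  forall (C : set (elt M)) (s : S) (p : set (pformula M s)),
    small K C ->
    (forall q, p q -> tup_in C (projT2 q).2) ->
    (forall q, finite_set q -> q `<=` p -> exists x, realizes x q) ->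
    exists x, realizes x p.

Definition strongly_homogeneous (K S : Type) (L : language S)
    (M : structure L) :=
  forall (D : set (elt M)) (h : forall s, M s -> M s),
    small K D -> elementary_on D h ->
    exists g : forall s, M s -> M s,
      automorphism g /\ forall e, D e -> emap g e = emap h e.

Definition monster (K S : Type) (L : language S) (M : structure L) : Prop :=
  saturated K M /\ strongly_homogeneous K M.

(** * Ternary relations on small subsets

    [ind A C B] stands for "A is independent from B over C". Only the values
    of [ind] on small sets are ever used.  [base] restricts the base sets
    of a property: [setT] gives the property itself, and [submodel T] the
    property over models. *)

Definition ternary (S : Type) (X : S -> Type) : Type :=
  set (elt X) -> set (elt X) -> set (elt X) -> Prop.

Section Properties.
Context (K S : Type) (L : language S) (M : structure L).
Implicit Types (base : set (set (elt M))) (ind : ternary M).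
Implicit Types A B C D : set (elt M).

Definition aut_invariant ind : Prop :=
  forall h : (forall s, M s -> M s), automorphism h ->
  forall A B C, small K A -> small K B -> small K C ->
    ind A C B -> ind (emap h @` A) (emap h @` C) (emap h @` B).

Definition normality ind : Prop :=
  forall A B C, small K A -> small K B -> small K C ->
    ind A C B -> ind A C (B `|` C).

Definition monotonicity base ind : Prop :=
  forall A B C D, small K A -> small K B -> small K C -> small K D ->
    base C -> ind A C (B `|` D) -> ind A C B.

Definition left_monotonicity base ind : Prop :=
  forall A B C D, small K A -> small K B -> small K C -> small K D ->
    base C -> ind (A `|` D) C B -> ind A C B.

Definition base_monotonicity ind : Prop :=
  forall A B C D, small K A -> small K B -> small K C -> small K D ->
    ind A C (B `|` D) -> ind A (C `|` D) B.

Definition transitivity base ind : Prop :=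
  forall A B C D, small K A -> small K B -> small K C -> small K D ->
    base C -> base B -> C `<=` B -> B `<=` D ->
    ind A C B -> ind A B D -> ind A C D.

Definition symmetry base ind : Prop :=
  forall A B C, small K A -> small K B -> small K C ->
    base C -> ind A C B -> ind B C A.

Definition full_existence ind : Prop :=
  forall A B C, small K A -> small K B -> small K C ->
    exists A', same_type C A' A /\ ind A' C B.

Definition finite_character base ind : Prop :=
  forall A B C, small K A -> small K B -> small K C -> base C ->
    (forall A0, finite_set A0 -> A0 `<=` A -> ind A0 C B) -> ind A C B.

(** The cardinal bounding [C] is itself small, and is given as that of some
    small [Z : set K]. *)
Definition local_character ind : Prop :=
  forall A, small K A -> exists Z : set K, small K Z /\
    forall B, small K B -> exists C, [/\ C `<=` B, card_lt C Z & ind A C B].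

Definition extension base ind : Prop :=
  forall A B C D, small K A -> small K B -> small K C -> small K D ->
    base C -> ind A C B ->
    exists A', same_type (B `|` C) A' A /\ ind A' C (B `|` D).

End Properties.

(** * Derivation-like theories *)

Section DerivationLike.
Context (K S : Type) (L : language S) (L0 : sublanguage L).
Context (U0 : structure L0) (ind0 : ternary U0) (T : theory L).

(** In (ii), the L0-structure [D] is a substructure of [U0], its L-structures
    are the [J : interp L (subsort (dom D))] with [reduct_interp L0 J] equal to
    that of [D]. *)
Definition derivation_like : Prop :=
  forall A B C : structure_in L U0,
    small K (dom A) -> small K (dom B) -> small K (dom C) ->
    models A (univ_part T) -> models B (univ_part T) ->
    models C (univ_part T) ->
    substr C A -> substr C B ->
    substr_of (reduct L0 A) -> substr_of (reduct L0 B) ->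
    acl (dom C) `&` dom A = dom C -> acl (dom C) `&` dom B = dom C ->
    ind0 (dom A) (dom C) (dom B) ->
    let amalgam (N : structure_in L U0) :=
      [/\ models N T, substr_of (reduct L0 N), substr A N & substr B N] in
    (exists N, amalgam N) /\
    (forall N, amalgam N ->
     forall D : structure_in L0 U0, substr_of D ->
       generated (dom A `|` dom B) `<=` dom D ->
       dom D `<=` acl (dom A `|` dom B) `&` dom N ->
       exists I : interp L (subsort (dom D)),
         substr (StructureIn I) N /\
         unique (fun J : interp L (subsort (dom D)) =>
           [/\ reduct_interp L0 J = dom_interp D,
               models (StructureIn J) (univ_part T),
               substr A (StructureIn J)
             & substr B (StructureIn J)]) I).

End DerivationLike.

(** The relation on subsets of [Up] induced by [ind0], where [acl] is computed
    in [Up] and the closures are then viewed as subsets of [U0]. *)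
Definition ind_plus (S : Type) (L : language S) (L0 : sublanguage L)
    (U0 : structure L0) (ind0 : ternary U0) (Up : structure_in L U0)
    : ternary Up :=
  fun A C B =>
    let i := emap (@incl S L U0 Up) in
    ind0 (i @` acl (A `|` C)) (i @` acl C) (i @` acl (B `|` C)).
Arguments ind_plus {S L L0 U0} ind0 Up A C B.

(* Main.v *)
From Stdlib Require List.
Require Import Defs.
From mathcomp Require Import all_boot.
From mathcomp Require Import boolp classical_sets functions cardinality.
Local Open Scope classical_set_scope.

(** The key step moves a small elementary substructure [M] of [Up].  If [rho]
    is an automorphism of [U0] over [C] with [M] independent from [rho M] over
    [C], then [M] and [rho M] amalgamate in a model of [T], hence in a model of
    [Tp]; both are elementary there by model completeness, so saturation of [Up]
    turns [rho] into an automorphism [g] of [Up] over [C], in such a way that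
    the pair [(g M, M)] is conjugate to [(M, rho M)] in [U0].  This gives full
    existence.

    It also shows that, under full existence for [ind0], a small substructure
    [D] of [Up] which is relatively [acl]-closed in the sense of [U0] is
    [acl]-closed in [Up]: the (finite) orbit [E] over [D] of an algebraic [e]
    outside [D] would meet every [rho E], whereas some conjugate of [E] over [D]
    avoids any given point of [E] that is not algebraic over [D] in [U0].
    Clause (ii) of derivation-likeness makes the trace on [Up] of the closure
    of [A E] in [U0] such a substructure, which yields base monotonicity.  For
    extension, quantifier elimination replaces the elementary substructure, and
    the uniqueness in (ii) controls the type.

    Local character is obtained by closing off under supports of finite sets
    in countably many steps; the uniform bound on these supports is where the
    cofinality of the cardinal enters, as a bound only depends on a type. *)

Set Implicit Arguments.
Unset Strict Implicit.
Unset Printing Implicit Defensive.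
Local Open Scope card_scope.

(** An automorphism of [U0] forgets the L-structure, so a set supplied by full existence of [ind0]
    carries only a transported L-structure, in general foreign to [Up]. The model that reconciles
    the two need not sit in [Up], and the way back runs between different structures; this is why
    partial elementary maps are sets of pairs between two structures. In the other direction,
    quantifier elimination of [T0] turns L0-isomorphisms between small subsets into restrictions of
    automorphisms of [U0], and independence is carried along these. In the orbit argument, the point
    to be avoided depends on an automorphism that is chosen last, so avoiding conjugates are
    prepared beforehand for every point of the finite orbit. The left argument of the induced
    relation is closed over the base. Passing to a finite part of it, or to a smaller base, shrinks
    it, and this is where left monotonicity enters finite character and transitivity. [K] is only a
    type, so sizes are compared through subsets [Z] of it, and everything rests on the square of an
    infinite set having the size of the set. *)

Lemma card_le_rel T U (A : set T) (B : set U) (R : T -> U -> Prop) :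
  (forall x, A x -> exists y, B y /\ R x y) ->
  (forall x x' y, A x -> A x' -> R x y -> R x' y -> x = x') -> A #<= B.
Proof.
move=> tot inj.
have [A0|/set0P[x0 Ax0]] := eqVneq A set0; first by rewrite A0 card_ge0.
have [y0 _] := tot _ Ax0.
have /choice[f fP] (x : T) : exists y, A x -> B y /\ R x y.
  have [Ax|nAx] := pselect (A x); first by have [y ?] := tot _ Ax; exists y.
  by exists y0.
have /injfunPex[g] : exists2 f : T -> U, set_fun A B f & set_inj A f.
  exists f => [x /fP[]//|x x' /set_mem Ax /set_mem Ax' e].
  by apply: (inj _ _ (f x)) => //; [case: (fP x Ax)|rewrite e; case: (fP x' Ax')].
exact: inj_card_le.
Qed.

Lemma card_le_fun T U (A : set T) (B : set U) : A #<= B -> U ->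
  exists f : T -> U, (forall x, A x -> B (f x)) /\
    (forall x x', A x -> A x' -> f x = f x' -> x = x').
Proof.
move=> /card_leP[f] y0.
exists (fun x => if pselect (A x) is left Ax
  then set_val (f (SigSub (mem_set Ax))) else y0); split.
  by move=> x Ax; case: pselect => // Ax'; exact/set_mem/valP.
move=> x x' Ax Ax'; case: pselect => // {}Ax; case: pselect => // {}Ax' e.
have : f (SigSub (mem_set Ax)) = f (SigSub (mem_set Ax')) by apply: val_inj.
by move=> /(@inj _ _ _ f); rewrite !inE => /(_ I I) [].
Qed.

(** A relation, unlike a function, needs no value outside [A], hence no element of [U]. *)
Lemma card_le_rel_ex T U (A : set T) (B : set U) : A #<= B ->
  exists R : T -> U -> Prop,
  (forall x, A x -> exists y, B y /\ R x y) /\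
  (forall x x' y, R x y -> R x' y -> x = x').
Proof.
move=> AB; have [A0|/set0P[x0 Ax0]] := eqVneq A set0.
  by exists (fun _ _ => False); split=> // x; rewrite A0.
have [B0|/set0P[y0 By0]] := eqVneq B set0.
  by move: AB; rewrite B0 card_le0 => /eqP A0; rewrite A0 in Ax0.
have [f [fB finj]] := card_le_fun AB y0.
exists (fun x y => A x /\ y = f x); split.
  by move=> x Ax; exists (f x); split; [exact: fB|].
by move=> x x' y [Ax ->] [Ax' /finj]; exact.
Qed.

(** Zorn's lemma on partial injections coded as sets of pairs: a maximal one that is neither total
    on [A] nor onto [B] could receive one more pair. *)
Lemma card_le_total T U (A : set T) (B : set U) : A #<= B \/ B #<= A.
Proof.
pose P := [set R : set (T * U) | (forall u, R u -> A u.1 /\ B u.2) /\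
  (forall u v, R u -> R v -> u.1 = v.1 <-> u.2 = v.2)].
have [F FP tot|R [[RAB Rinj] Rmax]] := @Zorn_bigcup (T * U)%type P.
  split=> [u [X /FP[XAB _] /XAB]//|u v [X FX Xu] [Y FY Yv]].
  by have [XY|YX] := tot _ _ FX FY; [have [_ ] := FP _ FY|have [_ ] := FP _ FX];
    apply=> //; [exact: XY|exact: YX].
have [cA|/existsNP[x /not_implyP[Ax nx]]] :=
  pselect (forall x, A x -> exists y, R (x, y)).
  left; apply: (@card_le_rel _ _ _ _ (fun x y => R (x, y))).
    by move=> x /cA[y Rxy]; exists y; split=> //; case: (RAB _ Rxy).
  by move=> x x' y _ _ Rx Rx'; apply/(Rinj _ _ Rx Rx').
have [cB|/existsNP[y /not_implyP[By ny]]] :=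
  pselect (forall y, B y -> exists x, R (x, y)).
  right; apply: (@card_le_rel _ _ _ _ (fun y x => R (x, y))).
    by move=> y /cB[x' Rxy]; exists x'; split=> //; case: (RAB _ Rxy).
  by move=> y y' x' _ _ Ry Ry'; apply/(Rinj _ _ Ry Ry').
exfalso; apply: (Rmax (R `|` [set (x, y)])).
  split=> [|u]; first exact: subsetUl.
  by apply: nx; exists y; apply: u; right.
split=> [u' [/RAB//|->//]|u v [Ru|->] [Rv|->]] //=; first exact: Rinj.
- split=> e; exfalso; [apply: nx; exists u.2|apply: ny; exists u.1].
    by rewrite -e -surjective_pairing.
  by rewrite -e -surjective_pairing.
- split=> e; exfalso; [apply: nx; exists v.2|apply: ny; exists v.1].
    by rewrite e -surjective_pairing.
  by rewrite e -surjective_pairing.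
Qed.

Lemma infinite_set_seq T (A : set T) : infinite_set A ->
  exists c : nat -> T, (forall n, A (c n)) /\ injective c.
Proof.
move=> iA; have [x0 _] := infinite_setN0 iA.
have /card_le_fun -/(_ x0) [c [cA cinj]] : [set: nat] #<= A by apply/infiniteP.
by exists c; split=> [n|m n]; [exact: cA|exact: cinj].
Qed.

(** * Squares, unions and finite sequences over an infinite set *)

Section Hessenberg.
Context (T : Type) (Z : set T).
Hypothesis iZ : infinite_set Z.

(** The field is read off the diagonal, so that a pairing and the set on which it lives form one
    object and inclusion orders both at once. *)
Let fld (R : set (T * T * T)) : set T := [set x | exists z, R (x, x, z)].

(** An injective pairing of the field into itself, possibly multivalued: totality and injectivity
    are all that a comparison of cardinals uses. *)
Let good (R : set (T * T * T)) :=
  [/\ forall x y z, R (x, y, z) -> [/\ fld R x, fld R y & fld R z],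
      fld R `<=` Z,
      forall x y, fld R x -> fld R y -> exists z, R (x, y, z)
    & forall x y x' y' z, R (x, y, z) -> R (x', y', z) -> x = x' /\ y = y'].

Let P := [set R | good R /\ (R = set0 \/ infinite_set (fld R))].

Let good_le R : good R -> fld R `*` fld R #<= fld R.
Proof.
move=> [Rf _ Rtot Rinj].
apply: (@card_le_rel _ _ _ _ (fun u z => R (u.1, u.2, z))).
  move=> [x y] [/= fx fy]; have [z Rz] := Rtot _ _ fx fy.
  by exists z; split=> //; case: (Rf _ _ _ Rz).
by move=> [x y] [x' y'] z _ _ /= Rx Rx'; case: (Rinj _ _ _ _ _ Rx Rx') => -> ->.
Qed.

Let good_chain (F : set (set (T * T * T))) :
  F `<=` P -> total_on F subset -> P (\bigcup_(X in F) X).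
Proof.
move=> FP tot; set R := \bigcup_(X in F) X.
have fldS X : F X -> fld X `<=` fld R by move=> FX x [z Xz]; exists z, X.
split; last first.
  have [all0|/existsNP[X /not_implyP[FX X0]]] :=
    pselect (forall X, F X -> X = set0).
    left; apply/seteqP; split=> // u [X FX]; by rewrite (all0 _ FX).
  right; have [_ [//|iX]] := FP _ FX.
  by apply: sub_infinite_set iX; exact: fldS.
split.
- move=> x y z [X FX Xu]; have [[Xf _ _ _] _] := FP _ FX.
  by have [? ? ?] := Xf _ _ _ Xu; split; apply: (fldS X).
- by move=> x [z [X FX Xx]]; have [[_ XZ _ _] _] := FP _ FX; apply: XZ; exists z.
- move=> x y [z [X FX Xx]] [t [Y FY Yy]].
  have [XY|YX] := tot _ _ FX FY.
    have [[_ _ Yt _] _] := FP _ FY.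
    have [||s Ys] := Yt x y; [by exists z; apply: XY|by exists t|].
    by exists s, Y.
  have [[_ _ Xt _] _] := FP _ FX.
  have [||s Xs] := Xt x y; [by exists z|by exists t; apply: YX|].
  by exists s, X.
- move=> x y x' y' z [X FX Xx] [Y FY Yy].
  have [XY|YX] := tot _ _ FX FY.
    have [[_ _ _ Yi] _] := FP _ FY; apply: Yi Yy; exact: XY.
  have [[_ _ _ Xi] _] := FP _ FX; apply: Xi Xx _; exact: YX.
Qed.

Let good_start : exists R, P R /\ R <> set0.
Proof.
have [c [cZ cinj]] := infinite_set_seq iZ.
have /card_le_fun -/(_ 0%N) [p [_ pinj]] : [set: nat * nat] #<= [set: nat].
  exact: countableP.
have {}pinj : injective p by move=> u v; apply: pinj.
pose R := [set u : T * T * T | exists m n, u = (c m, c n, c (p (m, n)))].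
have fc n : fld R (c n) by exists (c (p (n, n))), n, n.
have cf x : fld R x -> exists n, x = c n by move=> [z [m [n [-> _]]]]; exists m.
exists R; split; last first.
  move=> R0; have : R (c 0, c 0, c (p (0, 0))) by exists 0, 0.
  by rewrite R0.
split; last first.
  right; apply/infiniteP; apply: (@card_le_rel _ _ _ _ (fun n x => x = c n)).
    by move=> n _; exists (c n).
  by move=> n n' y _ _ -> /cinj.
split.
- move=> x y z [m [n [-> -> ->]]]; split; exact: fc.
- move=> x /cf[n ->]; exact: cZ.
- by move=> x y /cf[m ->] /cf[n ->]; exists (c (p (m, n))), m, n.
- move=> x y x' y' z [m [n [-> -> ->]]] [m' [n' [-> -> /cinj/pinj[-> ->]]]].
  by [].
Qed.

(** [g] copies the field into its complement. A pair with a coordinate in the copy is pulled back to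
    the field, coded there, tagged by which coordinates were copies, and the result is pushed into
    the copy. New values avoid the old field, so injectivity survives. *)
Let good_extend R : good R -> infinite_set (fld R) ->
  fld R #<= Z `\` fld R -> exists R', P R' /\ R `<` R'.
Proof.
move=> gR iR le; have [c [cR cinj]] := infinite_set_seq iR.
have [g [gZ ginj]] := card_le_fun le (c 0).
have [Rf RZ Rtot Rinj] := gR.
pose near b x x0 := fld R x0 /\ x = if b then x0 else g x0.
(* [true] marks a coordinate in the old field; the index separates the three combinations left once
   both flags being [true] is excluded. *)
pose k (b b' : bool) := c (b + 2 * b')%N.
pose N (u : T * T * T) := exists b b' x0 y0 w v,
  [/\ ~~ (b && b'), near b u.1.1 x0 /\ near b' u.1.2 y0,
      R (x0, y0, w), R (w, k b b', v) & u.2 = g v].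
pose R' := R `|` [set u | N u].
have R'tot b b' x x0 y y0 : near b x x0 -> near b' y y0 -> exists z, R' (x, y, z).
  move=> nx ny; have [w Rw] := Rtot _ _ nx.1 ny.1.
  have [bb|bb] := boolP (b && b').
    case/andP: bb nx ny => -> -> [_ ->] [_ ->]; exists w; by left.
  have [_ _ fw] := Rf _ _ _ Rw.
  have [v Rv] := Rtot w (k b b') fw (cR _).
  by exists (g v); right; exists b, b', x0, y0, w, v.
have nearf b x x0 : near b x x0 -> fld R' x
  by move=> nx; exact: (R'tot _ _ _ _ _ _ nx nx).
have fnear x : fld R' x -> exists b x0, near b x x0.
  move=> [z [Rx|[b [b' [x0 [y0 [w [v [_ [nx _] _ _ _]]]]]]]]].
    by exists true, x; split=> //; exists z.
  by exists b, x0.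
have fR' x : fld R x -> fld R' x by move=> fx; apply: (nearf true _ x).
have [g0Z g0R] := gZ _ (cR 0).
exists R'; split; last first.
  split; first exact: subsetUl.
  move=> R'R; apply: g0R.
  have [z Rz] : fld R' (g (c 0)) by apply: (nearf false _ (c 0)).
  by exists z; apply: R'R.
split; last first.
  by right; apply: sub_infinite_set iR => x /fR'.
split.
- move=> x y z [Rx|[b [b' [x0 [y0 [w [v [bb /= [nx ny] _ Rv ->]]]]]]]].
    by have [? ? ?] := Rf _ _ _ Rx; split; apply: fR'.
  split; [exact: nearf nx|exact: nearf ny|].
  by have [_ _ fv] := Rf _ _ _ Rv; apply: (nearf false _ v).
- move=> x /fnear[[] [x0 [fx ->]]]; first exact: RZ.
  by have [] := gZ _ fx.
- by move=> x y /fnear[b [x0 nx]] /fnear[b' [y0 ny]]; apply: R'tot nx ny.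
- move=> x y x' y' z [Rx|[b [b' [x0 [y0 [w [v [_ /= [nx ny] Rw Rv ez]]]]]]]];
    move=> [Rx'|[d [d' [x0' [y0' [w' [v' [_ /= [nx' ny'] Rw' Rv' ez']]]]]]]].
  + exact: Rinj Rx Rx'.
  + have [_ _ fz] := Rf _ _ _ Rx; have [_ _ fv] := Rf _ _ _ Rv'.
    by have [_] := gZ _ fv; rewrite -ez'.
  + have [_ _ fz] := Rf _ _ _ Rx'; have [_ _ fv] := Rf _ _ _ Rv.
    by have [_] := gZ _ fv; rewrite -ez.
  + have [_ _ fv] := Rf _ _ _ Rv; have [_ _ fv'] := Rf _ _ _ Rv'.
    have ev : v = v' by apply: ginj => //; rewrite -ez.
    subst v'; have [ew /cinj ek] := Rinj _ _ _ _ _ Rv Rv'.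
    have [? ?] : b = d /\ b' = d'.
      by move: ek; clear; case: b b' d d' => [] [] [] [].
    subst d d' w'; have [? ?] := Rinj _ _ _ _ _ Rw Rw'; subst x0' y0'.
    by rewrite nx.2 nx'.2 ny.2 ny'.2.
Qed.

(** The field of a maximal pairing has the size of [Z]: it cannot embed into its complement, by
    [good_extend], so the complement embeds into it, and [Z] fits into two copies of the field,
    hence into its square. *)
Lemma card_setX_infinite : Z `*` Z #<= Z.
Proof.
have [R [[gR R0] Rmax]] := Zorn_bigcup good_chain.
have {R0}iR : infinite_set (fld R).
  case: R0 => // R0; have [R' [PR' R'0]] := good_start.
  case: (Rmax R') => //; rewrite R0; split=> // sub; apply: R'0.
  by apply/seteqP; split.
have [le|le] := card_le_total (fld R) (Z `\` fld R).
  by have [R' [PR' lt]] := good_extend gR iR le; case: (Rmax _ lt PR').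
have [c [cR cinj]] := infinite_set_seq iR.
have [g [gR' ginj]] := card_le_fun le (c 0).
have ZR : Z #<= fld R.
  apply: card_le_trans (good_le gR).
  apply: (@card_le_rel _ _ _ _ (fun x u => (fld R x /\ u = (x, c 0)) \/
                                           (~ fld R x /\ u = (g x, c 1)))).
    move=> x Zx; have [fx|fx] := pselect (fld R x).
      by exists (x, c 0); split; [split; [|exact: cR]|left].
    by exists (g x, c 1); split; [split; [exact: gR'|exact: cR]|right].
  move=> x x' u Zx Zx' [[fx ->]|[fx ->]] [[fx' []]|[fx' []]].
  - by [].
  - by move=> _ /cinj.
  - by move=> _ /cinj.
  - by move=> e; apply: ginj.
have [f [fR finj]] := card_le_fun ZR (c 0).
have RZ : fld R #<= Z by apply: subset_card_le; case: gR.
apply: card_le_trans (card_le_trans (good_le gR) RZ).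
apply: (@card_le_rel _ _ _ _ (fun u v => v = (f u.1, f u.2))).
  by move=> [x y] [/= Zx Zy]; exists (f x, f y); split=> //; split; apply: fR.
by move=> [x y] [x' y'] v [/= ? ?] [/= ? ?] -> [/finj-> // /finj ->].
Qed.

Lemma card_setX_le U V (A : set U) (B : set V) :
  A #<= Z -> B #<= Z -> A `*` B #<= Z.
Proof.
move=> AZ BZ; apply: card_le_trans card_setX_infinite.
have [z0 _] := infinite_setN0 iZ.
have [f [fZ finj]] := card_le_fun AZ z0.
have [g [gZ ginj]] := card_le_fun BZ z0.
apply: (@card_le_rel _ _ _ _ (fun u v => v = (f u.1, g u.2))).
  move=> [x y] [/= Ax By]; exists (f x, g y); split=> //.
  by split; [apply: fZ|apply: gZ].
by move=> [x y] [x' y'] v [/= ? ?] [/= ? ?] -> [/finj-> // /ginj ->].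
Qed.

Lemma card_bigcup_le I U (J : set I) (F : I -> set U) :
  J #<= Z -> (forall i, J i -> F i #<= Z) -> \bigcup_(i in J) F i #<= Z.
Proof.
move=> JZ FZ; apply: card_le_trans (card_setX_le JZ (card_lexx Z)).
have /choice[R RP] (i : I) : exists R : U -> T -> Prop, J i ->
  (forall x, F i x -> exists y, Z y /\ R x y) /\
  (forall x x' y, R x y -> R x' y -> x = x').
  have [Ji|] := pselect (J i); last by exists (fun _ _ => True).
  by have [R ?] := card_le_rel_ex (FZ _ Ji); exists R.
apply: (@card_le_rel _ _ _ _ (fun x u => J u.1 /\ R u.1 x u.2)).
  move=> x [i Ji Fx]; have [y [Zy Ry]] := (RP i Ji).1 _ Fx.
  by exists (i, y).
by move=> x x' [i y] _ _ [/= Ji Rx] [_ Rx']; apply: (RP i Ji).2 Rx Rx'.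
Qed.

Lemma card_nat_le : [set: nat] #<= Z.
Proof. exact/infiniteP. Qed.

Lemma card_finite_le U (A : set U) : finite_set A -> A #<= Z.
Proof. by move=> /finite_set_countable fA; apply: card_le_trans fA card_nat_le. Qed.

Lemma card_setU_le U (A B : set U) : A #<= Z -> B #<= Z -> A `|` B #<= Z.
Proof.
move=> AZ BZ; have -> : A `|` B = \bigcup_(b in [set: bool]) if b then A else B.
  apply/seteqP; split=> [x [Ax|Bx]|x [[] _ ?]];
    [by exists true|by exists false|by left|by right].
apply: card_bigcup_le => [|[] _] //.
by apply: card_finite_le; exact: finite_finset.
Qed.

Lemma card_seq_le U (A : set U) : A #<= Z -> [set s | List.Forall A s] #<= Z.
Proof.
move=> AZ; pose S n := [set s | List.Forall A s /\ size s = n].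
have SZ n : S n #<= Z.
  elim: n => [|n IH].
    apply: card_le_trans card_nat_le.
    apply: (@card_le_rel _ _ _ _ (fun _ y => y = 0%N)); first by move=> *; exists 0%N.
    by move=> [|? ?] [|? ?] ? [_ ?] [_ ?].
  apply: card_le_trans (card_setX_le AZ IH).
  apply: (@card_le_rel _ _ _ _ (fun s u => s = u.1 :: u.2)).
    move=> [|x s] [h] // [ss]; exists (x, s); split=> //.
    by split=> /=; [exact: List.Forall_inv h|split=> //; exact: List.Forall_inv_tail h].
  by move=> ? ? ? _ _ -> ->.
have -> : [set s | List.Forall A s] = \bigcup_(n in [set: nat]) S n.
  by apply/seteqP; split=> [s h|s [n _ []]//]; exists (size s).
by apply: card_bigcup_le => [|n _]; [exact: card_nat_le|exact: SZ].
Qed.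

End Hessenberg.

(** * Finite sets and dependent pairs *)

Lemma finite_set_ind T (P : set T -> Prop) : P set0 ->
  (forall x A, finite_set A -> P A -> P (x |` A)) ->
  forall A, finite_set A -> P A.
Proof.
move=> P0 PS A [n]; elim: n A => [|n IH] A.
  by rewrite II0 card_eq0 => /eqP ->.
move=> /eq_cardSP[x Ax An]; rewrite -(setD1K Ax); apply: PS; last exact: IH.
by exists n.
Qed.

Lemma finite_set_list T (X : set T) : finite_set X ->
  exists l, X = [set x | List.In x l].
Proof.
move: X; apply: finite_set_ind => [|x A _ [l ->]].
  by exists [::]; apply/seteqP; split.
exists (x :: l); apply/seteqP; split=> y /=.
  by move=> [->|?]; [left|right].
by move=> [<-|?]; [left|right].
Qed.

Lemma finite_directed I (T : set I) (le : I -> I -> Prop) :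
  (forall i j k, le i j -> le j k -> le i k) ->
  T !=set0 ->
  (forall i j, T i -> T j -> exists k, [/\ T k, le k i & le k j]) ->
  forall Q, finite_set Q -> Q `<=` T -> exists k, T k /\ forall i, Q i -> le k i.
Proof.
move=> tr [i0 Ti0] dir; apply: finite_set_ind => [_|x A _ IH sub].
  by exists i0; split.
have [|k [Tk kA]] := IH; first by apply: subset_trans sub; exact: subsetUr.
have [|l [Tl lk lx]] := dir k x Tk; first by apply: sub; left.
by exists l; split=> // i [->//|/kA]; exact: tr.
Qed.

(** Sorts carry no decidable equality; proof irrelevance makes transport along a proof of [i = i]
    trivial. *)
Lemma existT_inj I (P : I -> Type) i (x y : P i) :
  existT P i x = existT P i y -> x = y.
Proof.
move=> e; have key (u v : {i & P i}) : u = v ->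
    exists h : projT1 u = projT1 v, eq_rect _ P (projT2 u) _ h = projT2 v.
  by move=> ->; exists erefl.
have [/= h] := key _ _ e.
by rewrite (Prop_irrelevance h erefl).
Qed.

(** * Tuples and contexts *)

Section Tuples.
Context (S : Type).
Implicit Types (G : seq S) (X Y : S -> Type).

(** The motive mentions a nonempty context, which blocks plain case analysis; [Q] generalises it by
    matching on the context. *)
Lemma var_cons_ind s G (P : forall t, var (s :: G) t -> Prop) :
  P s (@vz S s G) -> (forall t (v : var G t), P t (vs s v)) ->
  forall t v, P t v.
Proof.
move=> Pz Ps t v.
pose Q (D : seq S) : forall u, var D u -> Prop :=
  match D with
  | [::] => fun _ _ => True
  | r :: D' => fun u w => forall P' : (forall t, var (r :: D') t -> Prop),
     P' r (@vz S r D') -> (forall t (v : var D' t), P' t (vs r v)) -> P' u w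
  end.
suff : Q _ _ v by apply.
by case: v => [s' G'|s' G' t' v'] P' Pz' Ps'; [exact: Pz'|exact: Ps'].
Qed.

Lemma var_nil s (v : var (@nil S) s) : False.
Proof.
exact: (match v in var D _ return match D with [::] => False | _ :: _ => True end
  with vz _ _ => I | vs _ _ _ _ => I end).
Qed.

Definition ttail X s G (a : tup X (s :: G)) : tup X G := fun t v => a t (vs s v).

Lemma tup_ext X G (a b : tup X G) : (forall s v, a s v = b s v) -> a = b.
Proof. by move=> e; do 2 apply: functional_extensionality_dep => ?; exact: e. Qed.

Lemma tup_eta X s G (a : tup X (s :: G)) : a = tcons (a s (@vz S s G)) (ttail a).
Proof. by apply: tup_ext; exact: var_cons_ind. Qed.

Lemma tup_nil X (a b : tup X [::]) : a = b.
Proof. by apply: tup_ext => s v; case: (var_nil v). Qed.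

Lemma tmap_tcons X Y (h : forall s, X s -> Y s) s G (x : X s) (a : tup X G) :
  tmap h (tcons x a) = tcons (h s x) (tmap h a).
Proof. by apply: tup_ext; exact: var_cons_ind. Qed.

Lemma tup_in_tcons X (D : set (elt X)) s G (x : X s) (a : tup X G) :
  D (existT X s x) -> tup_in D a -> tup_in D (tcons x a).
Proof. by move=> Dx Da; exact: var_cons_ind. Qed.

Lemma sub_tup_in X (D E : set (elt X)) G (a : tup X G) :
  D `<=` E -> tup_in D a -> tup_in E a.
Proof. by move=> DE Da s v; exact/DE/Da. Qed.

Lemma tup_in_emap X Y (h : forall s, X s -> Y s) (D : set (elt X)) G (b : tup Y G) :
  tup_in (emap h @` D) b -> exists2 a : tup X G, tup_in D a & b = tmap h a.
Proof.
move=> Db; have P s v : exists x, D (existT X s x) /\ h s x = b s v.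
  have key z : (emap h @` D) z ->
      exists x, D (existT X (projT1 z) x) /\ h (projT1 z) x = projT2 z.
    by move=> [[t x] Dx <-]; exists x.
  exact: key (Db s v).
exists (fun s v => projT1 (cid (P s v))).
  by move=> s v; case: (cid _) => x [].
by apply: tup_ext => s v; rewrite /tmap; case: (cid _) => x [].
Qed.

Lemma tup_in_tmap X Y (h : forall s, X s -> Y s) (D : set (elt X)) G (a : tup X G) :
  tup_in D a -> tup_in (emap h @` D) (tmap h a).
Proof. by move=> Da s v; exists (existT X s (a s v)). Qed.

Definition range_tup X G (a : tup X G) : set (elt X) :=
  [set e | exists s v, e = existT X s (a s v)].

Lemma finite_range_tup X G (a : tup X G) : finite_set (range_tup a).
Proof.
elim: G a => [|s G IH] a.
  suff -> : range_tup a = set0 by [].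
  by apply/seteqP; split=> // e [s [v _]]; case: (var_nil v).
suff -> : range_tup a = existT X s (a s (@vz S s G)) |` range_tup (ttail a).
  by rewrite finite_setU; split=> //; exact: finite_set1.
apply/seteqP; split=> [_ [t [v ->]]|_ [->|[t [v ->]]]]; last by exists t, (vs s v).
  by move: t v; apply: var_cons_ind; [left|move=> t v; right; exists t, v].
by exists s, (@vz S s G).
Qed.

Lemma tup_in_range X G (a : tup X G) : tup_in (range_tup a) a.
Proof. by move=> s v; exists s, v. Qed.

Lemma range_tup_sub X G (a : tup X G) (D : set (elt X)) :
  tup_in D a <-> range_tup a `<=` D.
Proof.
by split=> [Da _ [s [v ->]]|sub s v]; [exact: Da|apply: sub; exists s, v].
Qed.

Lemma finite_is_range X (D : set (elt X)) : finite_set D ->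
  exists G (a : tup X G), D = range_tup a.
Proof.
move: D; apply: finite_set_ind => [|[s x] A _ [G [a ->]]].
  exists [::], (fun s v => False_rect _ (var_nil v)).
  by apply/seteqP; split=> // e [s [v _]]; case: (var_nil v).
exists (s :: G), (tcons x a); apply/seteqP; split.
  by move=> _ [->|[t [v ->]]]; [exists s, (@vz S s G)|exists t, (vs s v)].
move=> _ [t [v ->]]; move: t v.
by apply: var_cons_ind; [left|move=> t v; right; exists t, v].
Qed.

(** Lists live in one type for all contexts, so parameter tuples can be counted through them. *)
Fixpoint tlist X G : tup X G -> seq (elt X) :=
  match G return tup X G -> seq (elt X) with
  | [::] => fun _ => [::]
  | s :: G' => fun a => existT X s (a s (@vz S s G')) :: tlist (ttail a)
  end.

Lemma tlist_in X (D : set (elt X)) G (a : tup X G) :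
  tup_in D a -> List.Forall D (tlist a).
Proof.
elim: G a => [|s G IH] a Da /=; first exact: List.Forall_nil.
by apply: List.Forall_cons; [exact: Da|apply: IH => t v; exact: Da].
Qed.

Lemma tlist_inj X G (a b : tup X G) : tlist a = tlist b -> a = b.
Proof.
elim: G a b => [|s G IH] a b; first by move=> _; exact: tup_nil.
move=> /= [e1 /IH e2]; rewrite (tup_eta a) (tup_eta b) e2.
by rewrite (existT_inj e1).
Qed.

Definition renaming G G' := forall s, var G s -> var G' s.

Definition ren_id G : renaming G G := fun s v => v.

Definition ren_cons G G' (r : renaming G G') s : renaming (s :: G) (s :: G') :=
  @tcons S (var (s :: G')) s G (@vz S s G') (fun t v => vs s (r t v)).

Arguments ren_cons [G G'] r s _ _.
Arguments ren_id G _ _ : clear implicits.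

Definition precomp X G G' (r : renaming G G') (a : tup X G') : tup X G :=
  fun s v => a s (r s v).

Lemma precomp_ren_cons X G G' (r : renaming G G') s (x : X s) (a : tup X G') :
  precomp (ren_cons r s) (tcons x a) = tcons x (precomp r a).
Proof. by apply: tup_ext; exact: var_cons_ind. Qed.

(** Lets formulas with parameters in unrelated contexts be conjoined. *)
Lemma tup_merge X G1 G2 (a1 : tup X G1) (a2 : tup X G2) :
  exists G (a : tup X G) (r1 : renaming G1 G) (r2 : renaming G2 G),
    [/\ precomp r1 a = a1, precomp r2 a = a2 &
        forall D, tup_in D a1 -> tup_in D a2 -> tup_in D a].
Proof.
elim: G1 a1 => [|s G1 IH] a1.
  exists G2, a2, (fun s v => False_rect _ (var_nil v)), (ren_id G2).
  by split=> //; exact: tup_nil.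
have [G [a [r1 [r2 [e1 e2 Din]]]]] := IH (ttail a1).
exists (s :: G), (tcons (a1 s (@vz S s G1)) a), (ren_cons r1 s),
  (fun t v => vs s (r2 t v)); split.
- by rewrite precomp_ren_cons e1 -tup_eta.
- by rewrite -e2.
- move=> D D1 D2; apply: tup_in_tcons; first exact: D1.
  by apply: Din => // t v; exact: D1.
Qed.

(** The entries not taken from [D] share one variable, so that a formula over [D] and [z] becomes
    one in a single free variable over [D], the shape of a member of a type. *)
Lemma tup_isolate X (D : set (elt X)) (z : elt X) G (a : tup X G) :
  tup_in (D `|` [set z]) a ->
  exists G' (b : tup X G') (r : renaming G (projT1 z :: G')),
    tup_in D b /\ a = precomp r (tcons (projT2 z) b).
Proof.
elim: G a => [|s G IH] a Da.
  exists [::], (fun s v => False_rect _ (var_nil v)),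
    (fun s v => False_rect _ (var_nil v)).
  by split=> [s v|]; [case: (var_nil v)|exact: tup_nil].
have [|G' [b [r [Db e]]]] := IH (ttail a); first by move=> t v; exact: Da.
have [Dx|ez] := Da s (@vz S s G).
  pose r' t (v : var (projT1 z :: G') t) : var (projT1 z :: s :: G') t :=
    @tcons S (var (projT1 z :: s :: G')) (projT1 z) G' (@vz S _ _)
      (fun u w => vs _ (vs s w)) t v.
  exists (s :: G'), (tcons (a s (@vz S s G)) b),
   (@tcons S (var (projT1 z :: s :: G')) s G (vs _ (@vz S s G'))
      (fun t v => r' t (r t v))).
  split; first exact: tup_in_tcons.
  rewrite {1}(tup_eta a) e; apply: tup_ext; apply: var_cons_ind => // t v.
  rewrite /precomp /=; move: (r t v); clear.
  by move: t; apply: var_cons_ind.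
move: ez r e => /= <- /= r e; exists G', b,
   (@tcons S (var (s :: G')) s G (@vz S s G') r); split=> //.
by rewrite {1}(tup_eta a) e; apply: tup_ext; apply: var_cons_ind.
Qed.

End Tuples.

Arguments ren_cons [S G G'] r s _ _.

(** * Formulas *)

Section Formulas.
Context (S : Type) (L : language S).
Implicit Types G : seq S.

Fixpoint ren_term G G' (r : renaming G G') s (t : term L G s) : term L G' s :=
  match t in term _ _ s return term L G' s with
  | Var _ v => Var L (r _ v)
  | App f a => @App S L G' f (fun u v => ren_term r (a u v))
  end.

Fixpoint ren_formula G (p : formula L G) : forall G', renaming G G' -> formula L G' :=
  match p in formula _ G return forall G', renaming G G' -> formula L G' with
  | FFalse _ => fun _ _ => FFalse
  | FEq _ _ t u => fun _ r => FEq (ren_term r t) (ren_term r u)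
  | FRel _ f b => fun _ r => @FRel S L _ f (fun u v => ren_term r (b u v))
  | FImp _ p q => fun _ r => FImp (ren_formula p r) (ren_formula q r)
  | FAll _ s p => fun _ r => FAll (ren_formula p (ren_cons r s))
  end.

Definition FTrue G : formula L G := FImp FFalse FFalse.
Definition FAnd G (p q : formula L G) := FNot (FImp p (FNot q)).
Definition FEx G s (p : formula L (s :: G)) := FNot (FAll (FNot p)).

Arguments FAnd : simpl never.
Arguments FEx : simpl never.

Fixpoint fdepth G (p : formula L G) : nat :=
  if p is FImp _ _ q then (fdepth q).+1 else 0.

(** Valid even without sorts or symbols: nested implications from falsity are told apart by
    [fdepth]. *)
Lemma infinite_any_formula : infinite_set [set: any_formula L].
Proof.
apply/infiniteP; pose f n : formula L [::] := iter n (FImp FFalse) FFalse.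
have fd n : fdepth (f n) = n by elim: n => //= n ->.
apply: (@card_le_rel _ _ _ _ (fun n (y : any_formula L) => fdepth (projT2 y) = n)).
  by move=> n _; exists (existT _ [::] (f n)); split=> //=; exact: fd.
by move=> n n' y _ _ <- <-.
Qed.

Section Sat.
Context (M : structure L).

Lemma eval_ren G G' (r : renaming G G') (a : tup M G') s (t : term L G s) :
  eval a (ren_term r t) = eval (precomp r a) t.
Proof.
by elim: t => //= f b IH; congr (ifn _ _); apply: tup_ext.
Qed.

Lemma sat_ren G (p : formula L G) G' (r : renaming G G') (a : tup M G') :
  sat (ren_formula p r) a <-> sat p (precomp r a).
Proof.
elim: p G' r a => {G} [G|G s t u|G f b|G p IHp q IHq|G s p IH] G' r a //=.
- by rewrite !eval_ren.
- suff -> : (fun u v => eval a (ren_term r (b u v))) =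
            (fun u v => eval (precomp r a) (b u v)) by [].
  by apply: tup_ext => u v; rewrite eval_ren.
- by rewrite IHp IHq.
- by split=> h x; have := h x; rewrite IH precomp_ren_cons.
Qed.

Lemma sat_and G (p q : formula L G) (a : tup M G) :
  sat (FAnd p q) a <-> sat p a /\ sat q a.
Proof.
rewrite /FAnd; split=> /= [h|[pa qa] h]; last exact: h.
by split; apply: contrapT => n; apply: h => pa qa; exact: n.
Qed.

Lemma sat_ex G s (p : formula L (s :: G)) (a : tup M G) :
  sat (FEx p) a <-> exists x, sat p (tcons x a).
Proof.
rewrite /FEx; split=> /= [h|[x px] h]; last exact: h px.
by apply: contrapT => h'; apply: h => x px; apply: h'; exists x.
Qed.

End Sat.
End Formulas.

Arguments FAnd : simpl never.
Arguments FEx : simpl never.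

(** * Small sets *)

Lemma small_le K T U (A : set T) (B : set U) : A #<= B -> small K B -> small K A.
Proof. by move=> AB; apply: contra => /card_le_trans; apply. Qed.

Lemma small_sub K T (A B : set T) : A `<=` B -> small K B -> small K A.
Proof. by move=> /subset_card_le; exact: small_le. Qed.

Lemma small_image K T U (f : T -> U) (A : set T) : small K A -> small K (f @` A).
Proof. by apply: small_le; exact: card_image_le. Qed.

Lemma small_cover K T (A : set T) : small K A ->
  exists Z : set K, small K Z /\ A #<= Z.
Proof.
move=> sA; have [|AK] := card_le_total [set: K] A; first by move: sA => /negP.
have [K0|/set0P[k0 _]] := eqVneq [set: K] set0.
  by move: sA; rewrite /small /card_lt K0 card_ge0.
have [f [_ finj]] := card_le_fun AK k0.
exists (f @` A); split; first exact: small_image.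
apply: (@card_le_rel _ _ _ _ (fun x y => y = f x)).
  by move=> x Ax; exists (f x); split=> //; exists x.
by move=> x x' y Ax Ax' -> /finj; exact.
Qed.

Section SmallSets.
Context (K S : Type) (L : language S) (hL : small K [set: any_formula L]).

(** A single infinite small set above all the sizes at hand, to which the arithmetic of infinite
    sets applies; the formulas force it to be infinite. *)
Lemma small_bound T U (A : set T) (B : set U) : small K A -> small K B ->
  exists Z : set K, [/\ infinite_set Z, small K Z, [set: any_formula L] #<= Z,
    A #<= Z & B #<= Z].
Proof.
move=> /small_cover[ZA [sA AZ]] /small_cover[ZB [sB BZ]].
have [ZL [sL LZ]] := small_cover hL.
have [Z0 [s0 le1 le2]] : exists Z0 : set K, [/\ small K Z0, ZA #<= Z0 & ZB #<= Z0].
  by have [le|le] := card_le_total ZA ZB; [exists ZB|exists ZA].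
have [Z [s le3 le4]] : exists Z : set K, [/\ small K Z, Z0 #<= Z & ZL #<= Z].
  by have [le|le] := card_le_total Z0 ZL; [exists ZL|exists Z0].
have LZ' := card_le_trans LZ le4.
exists Z; split=> //; last 2 first.
- exact: card_le_trans AZ (card_le_trans le1 le3).
- exact: card_le_trans BZ (card_le_trans le2 le3).
apply/infiniteP; apply: card_le_trans LZ'; apply/infiniteP.
exact: infinite_any_formula.
Qed.

Lemma small_setU T (A B : set T) : small K A -> small K B -> small K (A `|` B).
Proof.
move=> sA sB; have [Z [iZ sZ _ AZ BZ]] := small_bound sA sB.
exact: small_le (card_setU_le iZ AZ BZ) sZ.
Qed.

Lemma small_bigcup I T U (J : set I) (B : set U) (F : I -> set T) :
  small K J -> small K B -> (forall i, J i -> F i #<= B) ->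
  small K (\bigcup_(i in J) F i).
Proof.
move=> sJ sB FB; have [Z [iZ sZ _ JZ BZ]] := small_bound sJ sB.
apply: small_le sZ; apply: card_bigcup_le => // i Ji.
exact: card_le_trans (FB _ Ji) BZ.
Qed.

Lemma small_finite T (A : set T) : finite_set A -> small K A.
Proof.
move=> fA; have [Z [iZ sZ _ _ _]] := small_bound hL hL.
by apply: small_le sZ; exact: card_finite_le.
Qed.

Section Params.
Context (M : structure L) (T : Type) (Z : set T) (iZ : infinite_set Z).
Context (C : set (elt M)) (LZ : [set: any_formula L] #<= Z) (CZ : C #<= Z).

(** The index set consists of pairs of a formula and a list of parameters. Used with [F] giving
    algebraic elements, then with [F] giving chosen witnesses. *)
Lemma card_params_le
    (F : forall s G, formula L (s :: G) -> tup M G -> set (elt M)) :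
  (forall s G (p : formula L (s :: G)) c, tup_in C c -> F s G p c #<= Z) ->
  [set e | exists s G (p : formula L (s :: G)) c, tup_in C c /\ F s G p c e] #<= Z.
Proof.
move=> FZ.
pose J := [set: any_formula L] `*` [set l | List.Forall C l].
pose F' (i : any_formula L * seq (elt M)) : set (elt M) :=
  [set e | exists s G (p : formula L (s :: G)) c,
    [/\ i = (existT _ (s :: G) p, tlist c), tup_in C c & F s G p c e]].
apply: (@card_le_trans _ _ _ (\bigcup_(i in J) F' i)).
  apply: subset_card_le => e [s [G [p [c [Cc Fe]]]]].
  exists (existT _ (s :: G) p, tlist c); last by exists s, G, p, c.
  by split=> //; exact: tlist_in.
apply: card_bigcup_le => // [|i Ji]; first by apply: card_setX_le => //; exact: card_seq_le.
have [->|/set0P[e [s [G [p [c [ei Cc Fe]]]]]]] := eqVneq (F' i) set0.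
  exact: card_ge0.
apply: card_le_trans (FZ s G p c Cc); apply: subset_card_le.
move=> e' [s' [G' [p' [c' [ei' Cc' Fe']]]]].
move: ei'; rewrite ei => -[es eG]; move: p' c' Cc' Fe'.
rewrite -es -eG => p' c' Cc' Fe' ep /tlist_inj ec.
by rewrite ec (existT_inj ep).
Qed.

Lemma card_acl_le : acl C #<= Z.
Proof.
pose F s G (p : formula L (s :: G)) (c : tup M G) : set (elt M) :=
  [set e | exists y, [/\ e = existT M s y, sat p (tcons y c) &
     finite_set [set y : M s | sat p (tcons y c)]]].
apply: (card_le_trans _ (card_params_le (F := F) _)).
  apply: subset_card_le => -[s x] [G [p [c [Cc px fin]]]].
  by exists s, G, p, c; split=> //; exists x.
move=> s G p c _; apply: card_finite_le => //.
have [fin|nfin] := pselect (finite_set [set y : M s | sat p (tcons y c)]).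
  apply: sub_finite_set (finite_image (existT M s) fin).
  by move=> _ [y [-> py _]]; exists y.
apply: sub_finite_set (@finite_set0 _) => e.
by move=> [y []].
Qed.

End Params.

Lemma small_acl (M : structure L) (C : set (elt M)) : small K C -> small K (acl C).
Proof.
move=> sC; have [Z [iZ sZ LZ CZ _]] := small_bound sC sC.
by apply: small_le sZ; exact: card_acl_le.
Qed.

End SmallSets.

(** * Embeddings and automorphisms *)

Section Embeddings.
Context (S : Type) (L : language S).
Implicit Types M N P : structure L.

Lemma embedding_eval M N (h : forall s, M s -> N s) : embedding h ->
  forall G s (t : term L G s) (a : tup M G), h s (eval a t) = eval (tmap h a) t.
Proof.
move=> [_ hf _] G s t a; elim: t => //= f b IH.
by rewrite hf; congr (ifn _ _); apply: tup_ext => u v; exact: IH.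
Qed.

Lemma embedding_qf M N (h : forall s, M s -> N s) : embedding h ->
  forall G (p : formula L G) (a : tup M G), qfree p ->
  sat p a <-> sat p (tmap h a).
Proof.
move=> eh G p a; elim: p a => {G} [G|G s t u|G f b|G p IHp q IHq|G s p IH] a //=.
- by rewrite -!(embedding_eval eh); case: eh => inj _ _; split=> [->|/inj].
- case: (eh) => _ _ hr _; rewrite hr.
  suff -> : tmap h (fun u v => eval a (b u v)) =
            (fun u v => eval (tmap h a) (b u v)) by [].
  by apply: tup_ext => u v; rewrite -embedding_eval.
- by move=> [qp qq]; rewrite IHp // IHq.
Qed.

Lemma embedding_comp M N P (h : forall s, M s -> N s) (k : forall s, N s -> P s) :
  embedding h -> embedding k -> embedding (fun s x => k s (h s x)).
Proof.
move=> [h1 h2 h3] [k1 k2 k3]; split.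
- by move=> s x y /k1/h1.
- by move=> f a; rewrite h2 k2.
- by move=> r a; rewrite h3 k3.
Qed.

Lemma embedding_cancel M N P (h : forall s, M s -> N s) (k : forall s, N s -> P s) :
  embedding k -> embedding (fun s x => k s (h s x)) -> embedding h.
Proof.
move=> [k1 k2 k3] [h1 h2 h3]; split.
- by move=> s x y e; apply: h1; rewrite e.
- by move=> f a; apply: k1; rewrite h2 k2.
- by move=> r a; rewrite h3 k3.
Qed.

Lemma embedding_id M : embedding (fun s (x : M s) => x).
Proof. by split=> // s x y. Qed.

Lemma embedding_inv M N (h : forall s, M s -> N s) (k : forall s, N s -> M s) :
  embedding h -> (forall s y, h s (k s y) = y) -> embedding k.
Proof.
move=> eh hk; apply: (embedding_cancel eh).
suff -> : (fun s x => h s (k s x)) = (fun s x => x) by exact: embedding_id.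
by do 2 apply: functional_extensionality_dep => ?.
Qed.

Lemma universal_embedding M N (h : forall s, M s -> N s) : embedding h ->
  forall G (p : formula L G) (a : tup M G), universal p ->
  sat p (tmap h a) -> sat p a.
Proof.
move=> eh G p a up; elim: up a => {G p} [G p qp|G s p _ IH] a /=.
  by rewrite (embedding_qf eh).
by move=> sp x; apply: IH; rewrite tmap_tcons.
Qed.

Lemma models_univ M N (h : forall s, M s -> N s) (T : theory L) : embedding h ->
  models N (univ_part T) -> models M (univ_part T).
Proof.
move=> eh NT p pT; apply: (universal_embedding eh); first by case: pT.
by rewrite (tup_nil (tmap h _) (@tnil S N)); exact: NT.
Qed.

Lemma models_univ_part M (T : theory L) : models M T -> models M (univ_part T).
Proof. by move=> MT p [_]; exact. Qed.

Lemma iso_elementary M N (h : forall s, M s -> N s) : embedding h ->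
  (forall s y, exists x, h s x = y) ->
  forall G (p : formula L G) (a : tup M G), sat p a <-> sat p (tmap h a).
Proof.
move=> eh sh G p a; elim: p a => {G} [G|G s t u|G f b|G p IHp q IHq|G s p IH] a.
- by [].
- exact: (embedding_qf eh).
- exact: (embedding_qf eh).
- by rewrite /= IHp IHq.
- split=> /= hp y; last by rewrite IH tmap_tcons.
  by have [x <-] := sh _ y; rewrite -tmap_tcons -IH.
Qed.

Lemma iso_models M N (h : forall s, M s -> N s) (T : theory L) : embedding h ->
  (forall s y, exists x, h s x = y) -> models M T -> models N T.
Proof.
move=> eh sh MT p /MT; rewrite (iso_elementary eh sh).
by rewrite (tup_nil (tmap _ _) (@tnil S N)).
Qed.

Lemma aut_elementary M (h : forall s, M s -> M s) : automorphism h ->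
  forall G (p : formula L G) (a : tup M G), sat p a <-> sat p (tmap h a).
Proof. by case; exact: iso_elementary. Qed.

Lemma aut_comp M (h k : forall s, M s -> M s) :
  automorphism h -> automorphism k -> automorphism (fun s x => h s (k s x)).
Proof.
move=> [eh sh] [ek sk]; split; first exact: embedding_comp.
by move=> s y; have [z <-] := sh _ y; have [x <-] := sk _ z; exists x.
Qed.

Lemma aut_id M : automorphism (fun s (x : M s) => x).
Proof. by split=> [|s y]; [exact: embedding_id|exists y]. Qed.

Lemma aut_inv M (h : forall s, M s -> M s) : automorphism h ->
  exists k, [/\ automorphism k, forall s x, h s (k s x) = x &
    forall s x, k s (h s x) = x].
Proof.
move=> [eh sh]; have [inj _ _] := eh.
pose k s y := projT1 (cid (sh s y)).
have hk s y : h s (k s y) = y by rewrite /k; case: cid.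
have kh s y : k s (h s y) = y by apply: inj; rewrite hk.
by exists k; split=> //; split=> [|s y]; [exact: embedding_inv hk|exists (h s y)].
Qed.

End Embeddings.

Lemma emap_comp S (X Y Z : S -> Type) (h : forall s, X s -> Y s)
    (k : forall s, Y s -> Z s) (D : set (elt X)) :
  emap k @` (emap h @` D) = emap (fun s x => k s (h s x)) @` D.
Proof.
apply/seteqP; split=> [_ [_ [e De <-] <-]|_ [e De <-]]; first by exists e.
by exists (emap h e) => //; exists e.
Qed.

Lemma emap_fix S (X : S -> Type) (h : forall s, X s -> X s) (D : set (elt X)) :
  (forall e, D e -> emap h e = e) -> emap h @` D = D.
Proof.
move=> fix_; apply/seteqP; split=> [_ [e De <-]|e De]; first by rewrite fix_.
by exists e => //; exact: fix_.
Qed.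

Lemma emap_eq S (X Y : S -> Type) (h k : forall s, X s -> Y s) (D : set (elt X)) :
  (forall e, D e -> emap h e = emap k e) -> emap h @` D = emap k @` D.
Proof.
by move=> hk; apply/seteqP; split=> _ [e De <-]; exists e => //; rewrite hk.
Qed.

Lemma emap_inj S (X Y : S -> Type) (h : forall s, X s -> Y s) :
  (forall s, injective (h s)) -> injective (emap h).
Proof.
move=> inj [s x] [t y] e.
have est : s = t by move: (f_equal (@projT1 _ _) e).
by move: y e; rewrite -est => y e2; rewrite (inj s x y (existT_inj e2)).
Qed.

Lemma emap_eqE S (X : S -> Type) (h k : forall s, X s -> X s) s x :
  emap h (existT X s x) = emap k (existT X s x) -> h s x = k s x.
Proof. exact: existT_inj. Qed.

(** * Partial elementary relations *)

Section PartialElementary.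
Context (S : Type) (L : language S).
Implicit Types M N P : structure L.

Definition pairs (X Y : S -> Type) : S -> Type := fun s => (X s * Y s)%type.
Definition pfst X Y s (z : pairs X Y s) : X s := z.1.
Definition psnd X Y s (z : pairs X Y s) : Y s := z.2.

(** With a set of pairs, no value outside the domain has to be supplied, and extension, composition
    and unions of chains become operations on sets. *)
Definition pelem M N (R : set (elt (pairs M N))) : Prop :=
  forall G (p : formula L G) (w : tup (pairs M N) G), tup_in R w ->
    sat p (tmap (@pfst M N) w) <-> sat p (tmap (@psnd M N) w).

Definition pqf M N (R : set (elt (pairs M N))) : Prop :=
  forall G (p : formula L G) (w : tup (pairs M N) G), qfree p -> tup_in R w ->
    sat p (tmap (@pfst M N) w) <-> sat p (tmap (@psnd M N) w).

Lemma pelem_sub M N (R R' : set (elt (pairs M N))) :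
  R `<=` R' -> pelem R' -> pelem R.
Proof. by move=> RR' pR' G p w Rw; apply: pR'; exact: sub_tup_in Rw. Qed.

Lemma pelem_half M N (R : set (elt (pairs M N))) :
  (forall G (p : formula L G) (w : tup (pairs M N) G), tup_in R w ->
    sat p (tmap (@pfst M N) w) -> sat p (tmap (@psnd M N) w)) -> pelem R.
Proof.
move=> h G p w Rw; split; first exact: h.
by move=> p2; apply: contrapT => p1; exact: (h _ (FNot p) w Rw p1 p2).
Qed.

(** Preservation of the equality of two variables makes the relation a partial injection. *)
Lemma pelem_fun M N (R : set (elt (pairs M N))) s x y x' y' : pelem R ->
  R (existT _ s (x, y)) -> R (existT _ s (x', y')) -> x = x' <-> y = y'.
Proof.
move=> pR Ry Ry'.
pose v0 : var [:: s; s] s := @vz S s [:: s].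
pose v1 : var [:: s; s] s := vs s (@vz S s [::]).
pose w : tup (pairs M N) [:: s; s] :=
  tcons ((x, y) : pairs M N s) (tcons ((x', y') : pairs M N s) (@tnil S (pairs M N))).
have := pR _ (FEq (Var L v0) (Var L v1)) w; apply.
apply: tup_in_tcons => //; apply: tup_in_tcons => // t v; case: (var_nil v).
Qed.

Definition pdom M N (R : set (elt (pairs M N))) : set (elt M) := emap (@pfst M N) @` R.

Lemma pelem_card M N (R : set (elt (pairs M N))) : pelem R -> R #<= pdom R.
Proof.
move=> pR; apply: (@card_le_rel _ _ _ _ (fun z x => x = emap (@pfst M N) z)).
  by move=> z Rz; exists (emap (@pfst M N) z); split=> //; exists z.
move=> [s [x y]] [t [x' y']] e Rz Rz' -> /= E.
have est : s = t by move: (f_equal (@projT1 _ _) E).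
move: x' y' Rz' E; rewrite -est => x' y' Rz' E.
have /= xx := existT_inj E.
by rewrite -((pelem_fun pR Rz Rz').1 xx) xx.
Qed.

(** The type of [q] over the domain of [R], rewritten along [R] as a type over its range. *)
Definition transport_type M N (R : set (elt (pairs M N))) s (q : M s)
    : set (pformula N s) :=
  [set phi | exists G p (w : tup (pairs M N) G),
    [/\ phi = existT _ G (p, tmap (@psnd M N) w), tup_in R w &
        sat p (tcons q (tmap (@pfst M N) w))]].

(** Conjunction, after merging contexts, makes the type directed under implication in [N]; a finite
    part is then implied by one of its members. *)
Lemma transport_type_conj M N (R : set (elt (pairs M N))) s (q : M s) Q :
  finite_set Q -> Q `<=` transport_type R q ->
  exists G (p : formula L (s :: G)) (w : tup (pairs M N) G),
    [/\ tup_in R w, sat p (tcons q (tmap (@pfst M N) w)) &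
      forall x, sat p (tcons x (tmap (@psnd M N) w)) -> realizes x Q].
Proof.
move=> fQ QT.
pose le (phi psi : pformula N s) := forall x : N s,
  sat (projT2 phi).1 (tcons x (projT2 phi).2) ->
  sat (projT2 psi).1 (tcons x (projT2 psi).2).
have [|||_ [[G [p [w [-> Rw pq]]]] pQ]] := @finite_directed _ _ le _ _ _ Q fQ QT.
- by move=> i j k ij jk x /ij/jk.
- exists (existT _ [::] (FTrue L [:: s], tmap (@psnd M N) (@tnil S (pairs M N)))).
  exists [::], (FTrue L [:: s]), (@tnil S (pairs M N)).
  by split=> // t v; case: (var_nil v).
- move=> _ _ [G1 [p1 [w1 [-> Rw1 pq1]]]] [G2 [p2 [w2 [-> Rw2 pq2]]]].
  have [G [w [r1 [r2 [e1 e2 Rw]]]]] := tup_merge w1 w2.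
  have E1 : precomp r1 (tmap (@psnd M N) w) = tmap (@psnd M N) w1 by rewrite -e1.
  have E2 : precomp r2 (tmap (@psnd M N) w) = tmap (@psnd M N) w2 by rewrite -e2.
  have E3 : precomp r1 (tmap (@pfst M N) w) = tmap (@pfst M N) w1 by rewrite -e1.
  have E4 : precomp r2 (tmap (@pfst M N) w) = tmap (@pfst M N) w2 by rewrite -e2.
  pose p := FAnd (ren_formula p1 (ren_cons r1 s)) (ren_formula p2 (ren_cons r2 s)).
  have pE (P : structure L) (x : P s) a : sat p (tcons x a) <->
      sat p1 (tcons x (precomp r1 a)) /\ sat p2 (tcons x (precomp r2 a)).
    by rewrite /p sat_and !sat_ren !precomp_ren_cons.
  clearbody p.
  exists (existT _ G (p, tmap (@psnd M N) w)); split.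
  + exists G, p, w; split=> //; first exact: Rw.
    by rewrite pE E3 E4.
  + by move=> x /=; rewrite pE E1 => -[].
  + by move=> x /=; rewrite pE E2 => -[].
- by exists G, p, w; split=> // x px phi /pQ; apply.
Qed.

(** Finite satisfiability of the type over the range of [R] corresponding to
    that of [q] over its domain comes from existential formulas. *)
Lemma pelem_add K M N (R : set (elt (pairs M N))) s (q : M s) :
  saturated K N -> pelem R -> small K R ->
  exists y : N s, pelem (R `|` [set existT (pairs M N) s (q, y)]).
Proof.
move=> satN pR sR.
have [||Q fQ QT|y yT] := satN (emap (@psnd M N) @` R) s (transport_type R q).
- exact: small_image.
- by move=> _ [G [p [w [-> Rw _]]]]; exact: tup_in_tmap.
- have [G [p [w [Rw pq pQ]]]] := transport_type_conj fQ QT.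
  have /sat_ex[x px] : sat (FEx p) (tmap (@psnd M N) w).
    by apply/(pR _ _ _ Rw)/sat_ex; exists q.
  by exists x; exact: pQ.
exists y; apply: pelem_half => G p w /tup_isolate[G' [w' [r [Rw' ->]]]] /=.
rewrite -[tmap _ (precomp r _)]/(precomp r (tmap _ _)) -sat_ren tmap_tcons => pq.
rewrite -[tmap _ (precomp r _)]/(precomp r (tmap _ _)) -sat_ren tmap_tcons.
apply: (yT (existT _ G' (ren_formula p r, tmap (@psnd M N) w'))).
by exists G', (ren_formula p r), w'.
Qed.

(** A tuple has finitely many entries, so one member of the chain is enough; the first alternative
    takes care of the empty chain. *)
Lemma tup_in_chain (X : S -> Type) (R : set (elt X)) (F : set (set (elt X))) G
    (w : tup X G) : total_on F subset ->
  tup_in (R `|` \bigcup_(Y in F) Y) w ->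
  tup_in R w \/ exists2 Y, F Y & tup_in (R `|` Y) w.
Proof.
move=> tot; elim: G w => [|s G IH] w Rw.
  by left=> s v; case: (var_nil v).
have [t v|Rt|[Y FY Yt]] := IH (ttail w); first exact: Rw.
  have [Rs|[Y FY Ys]] := Rw s (@vz S s G).
    by left; rewrite (tup_eta w); exact: tup_in_tcons.
  right; exists Y => //; rewrite (tup_eta w); apply: tup_in_tcons; first by right.
  by move=> t v; left; exact: Rt.
right; have [Rs|[Y' FY' Ys]] := Rw s (@vz S s G).
  by exists Y => //; rewrite (tup_eta w); apply: tup_in_tcons => //; left.
have [YY|YY] := tot _ _ FY FY'.
  exists Y' => //; rewrite (tup_eta w); apply: tup_in_tcons; first by right.
  by apply: sub_tup_in Yt => e [?|/YY ?]; [left|right].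
by exists Y => //; rewrite (tup_eta w); apply: tup_in_tcons => //; right; exact: YY.
Qed.

(** Zorn's lemma replaces an enumeration of [Q]. Keeping the added domain inside [Q] keeps every
    extension small, so [pelem_add] applies to a maximal one. *)
Lemma pelem_extend K M N (R : set (elt (pairs M N))) (Q : set (elt M)) :
  saturated K N -> pelem R -> small K (pdom R `|` Q) ->
  exists R', [/\ R `<=` R', pelem R' &
    forall s x, Q (existT M s x) -> exists y, R' (existT (pairs M N) s (x, y))].
Proof.
move=> satN pR sRQ.
pose P := [set X : set (elt (pairs M N)) | pelem (R `|` X) /\ pdom X `<=` Q].
have [F FP tot|X [[pX XQ] Xmax]] := @Zorn_bigcup _ P.
  split.
    move=> G p w /tup_in_chain -/(_ tot)[Rw|[Y FY Yw]]; first exact: pR.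
    by have [pY _] := FP _ FY; exact: pY.
  move=> _ [z [Y FY Yz] <-]; have [_] := FP _ FY; apply; by exists z.
exists (R `|` X); split=> [| //|s x Qx]; first exact: subsetUl.
have [|y] := pelem_add x satN pX.
  apply: small_le (pelem_card pX) _; apply: small_sub sRQ.
  move=> _ [z [Rz|Xz] <-]; [left|right]; first by exists z.
  by apply: XQ; exists z.
rewrite -setUA => py; exists y; right; apply: contrapT => nX.
apply: (Xmax (X `|` [set existT (pairs M N) s (x, y)])).
  by split=> [|sub]; [exact: subsetUl|apply: nX; apply: sub; right].
by split=> // _ [z [Xz|->] <-] //; apply: XQ; exists z.
Qed.

Lemma pelem_aut K M (R : set (elt (pairs M M))) :
  strongly_homogeneous K M -> pelem R -> small K (pdom R) ->
  exists g, automorphism g /\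
    forall s x y, R (existT (pairs M M) s (x, y)) -> g s x = y.
Proof.
move=> hom pR sR.
(* Homogeneity is stated for total maps; the identity serves as default outside the domain. *)
pose h s (x : M s) : M s :=
  if pselect (exists y, R (existT (pairs M M) s (x, y))) is left e
  then projT1 (cid e) else x.
have Rh s x y : R (existT (pairs M M) s (x, y)) -> R (existT (pairs M M) s (x, h s x)).
  by rewrite /h; case: pselect => [e _|ne Ry]; [case: cid|case: ne; exists y].
have Rh' e : pdom R e -> R (existT (pairs M M) (projT1 e) (projT2 e, h _ (projT2 e))).
  by move=> [[s [x y]] Rz <-]; exact: Rh Rz.
have [|g [ag gh]] := hom (pdom R) h sR.
  move=> G p a Da; pose w : tup (pairs M M) G := fun s v => (a s v, h s (a s v)).
  by apply: (pR G p w) => s v; exact: Rh' (Da s v).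
exists g; split=> // s x y Rz.
have E : emap g (existT M s x) = emap h (existT M s x).
  by apply: gh; exists (existT (pairs M M) s (x, y)).
rewrite (emap_eqE E).
exact/(pelem_fun pR (Rh _ _ _ Rz) Rz).
Qed.

Lemma qe_pelem (T : theory L) M N (R : set (elt (pairs M N))) :
  quantifier_elimination T -> models M T -> models N T -> pqf R -> pelem R.
Proof.
move=> qe MT NT qR G p w Rw; have [q [qq pq]] := qe _ p.
by rewrite (pq _ MT) (pq _ NT); exact: qR.
Qed.

End PartialElementary.

Lemma proj1_sig_inj T (P : T -> Prop) : injective (@proj1_sig T P).
Proof. by move=> [x Px] [y Py] /= xy; exact: eq_exist. Qed.

(** * Injectivity of the translation of L0-formulas into L-formulas *)

Section LiftInjective.
Context (S : Type) (L : language S) (L0 : sublanguage L).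

(** Partial inverses of the constructors, with their indices packed, take the place of inversion on
    a dependent family. *)
Let unvar G s (t : term L G s) : option {s & var G s} :=
  if t is Var s v then Some (existT _ s v) else None.
Let unapp G s (t : term L G s) : option {f : Defs.fsym L & tup (term L G) (fdom f)} :=
  if t is App f a then Some (existT _ f a) else None.

Lemma lift_term_inj_dep G s (t : term L0 G s) s' (t' : term L0 G s') :
  existT (term L G) s (lift_term t) = existT (term L G) s' (lift_term t') ->
  existT (term L0 G) s t = existT (term L0 G) s' t'.
Proof.
elim: t s' t' => [u v|f a IH] s' [u' v'|f' a'] e.
- have : unvar (lift_term (Var L0 v)) = unvar (lift_term (Var L0 v')).
    exact: (f_equal (fun z => unvar (projT2 z)) e).
  move=> e0; have e1 := Some_inj e0.
  exact: (f_equal (fun z => existT (term L0 G) (projT1 z) (Var L0 (projT2 z))) e1).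
- by have := f_equal (fun z => unvar (projT2 z)) e.
- by have := f_equal (fun z => unvar (projT2 z)) e.
- have e1 := f_equal (fun z => unapp (projT2 z)) e.
  have {e1}/= e1 := Some_inj e1.
  have ff : f = f' by apply: proj1_sig_inj; exact: (f_equal (@projT1 _ _) e1).
  move: a' e e1; rewrite -ff => a' _ e2; have {e2}e1 := existT_inj e2.
  suff -> : a = a' by [].
  apply: tup_ext => r v; apply: existT_inj (IH r v _ (a' r v) _).
  by congr existT; exact: (f_equal (fun b => b r v) e1).
Qed.

Lemma lift_term_inj G s : injective (@lift_term S L L0 G s).
Proof. by move=> t t' e; apply: existT_inj; apply: lift_term_inj_dep; rewrite e. Qed.

Let uneq G (p : formula L G) : option {s & (term L G s * term L G s)%type} :=
  if p is FEq _ s t u then Some (existT _ s (t, u)) else None.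
Let unrel G (p : formula L G) : option {r : rsym L & tup (term L G) (rdom r)} :=
  if p is FRel _ r b then Some (existT _ r b) else None.
Let unimp G (p : formula L G) : option (formula L G * formula L G) :=
  if p is FImp _ p q then Some (p, q) else None.
Let unall G (p : formula L G) : option {s & formula L (s :: G)} :=
  if p is FAll _ s p then Some (existT _ s p) else None.

Lemma lift_formula_inj G : injective (@lift_formula S L L0 G).
Proof.
move=> p; elim: p => {G} [G|G s t u|G r b|G p IHp q IHq|G s p IH] p'.
- by case: p'.
- case: p' t u => // G' s' t' u' t u e.
  have {e}/= e := Some_inj (f_equal (@uneq _) e).
  have ss : s = s' by exact: (f_equal (@projT1 _ _) e).
  move: t' u' e; rewrite -ss => t' u' e.
  by have [/lift_term_inj -> /lift_term_inj ->] := existT_inj e.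
- case: p' b => // G' r' b' b e.
  have {e}/= e := Some_inj (f_equal (@unrel _) e).
  have rr : r = r' by apply: proj1_sig_inj; exact: (f_equal (@projT1 _ _) e).
  move: b' e; rewrite -rr => b' e0; have e := existT_inj e0.
  congr FRel; apply: tup_ext => s v; apply: lift_term_inj.
  exact: (f_equal (fun b => b s v) e).
- case: p' p q IHp IHq => // G' p' q' p q IHp IHq e.
  have {e}/= [/IHp -> /IHq ->] := Some_inj (f_equal (@unimp _) e).
  by [].
- case: p' p IH => // G' s' p' p IH e.
  have {e}/= e := Some_inj (f_equal (@unall _) e).
  have ss : s = s' by exact: (f_equal (@projT1 _ _) e).
  by move: p' e; rewrite -ss => p' e; rewrite (IH _ (existT_inj e)).
Qed.

Lemma small_sub_formulas K : small K [set: any_formula L] -> small K [set: any_formula L0].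
Proof.
apply: small_le; apply: (@card_le_rel _ _ _ _
  (fun x y => y = existT (formula L) (projT1 x) (lift_formula (projT2 x)))).
  by move=> x _; eexists; split; last reflexivity.
move=> [G p] [G' p'] y _ _ -> /= e.
have GG : G = G' by exact: (f_equal (@projT1 _ _) e).
by move: p' e; rewrite -GG => p' e; rewrite (lift_formula_inj (existT_inj e)).
Qed.

End LiftInjective.

(** * Algebraic closure *)

Section Acl.
Context (S : Type) (L : language S) (M : structure L).
Implicit Types (C D : set (elt M)) (g h : forall s, M s -> M s).

Definition fixes C g := forall e, C e -> emap g e = e.

Lemma fixes_tmap C g G (c : tup M G) : fixes C g -> tup_in C c -> tmap g c = c.
Proof. by move=> fg Cc; apply: tup_ext => s v; exact: existT_inj (fg _ (Cc s v)). Qed.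

Lemma fixes_sub C D g : C `<=` D -> fixes D g -> fixes C g.
Proof. by move=> CD fg e /CD/fg. Qed.

Lemma fixes_inv C g h : fixes C g -> (forall s x, h s (g s x) = x) -> fixes C h.
Proof.
by move=> fg hg [s x] /[dup] Ce /fg {1}<-; rewrite /emap /= hg.
Qed.

Lemma fixes_comp C g h : fixes C g -> fixes C h -> fixes C (fun s x => g s (h s x)).
Proof.
move=> fg fh e Ce; rewrite -{2}(fg e Ce) -{2}(fh e Ce) //.
Qed.

Lemma acl_ext C : C `<=` acl C.
Proof.
move=> [s x] Cx; exists [:: s].
exists (FEq (Var L (@vz S s [:: s])) (Var L (vs s (@vz S s [::])))).
exists (tcons x (@tnil S M)); split=> //.
  by apply: tup_in_tcons => // t v; case: (var_nil v).
by apply: sub_finite_set (finite_set1 x).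
Qed.

Lemma acl_mono C D : C `<=` D -> acl C `<=` acl D.
Proof.
by move=> CD e [G [p [c [Cc pe fin]]]]; exists G, p, c; split=> //; exact: sub_tup_in Cc.
Qed.

Lemma acl_finite C e : acl C e ->
  exists C0, [/\ finite_set C0, C0 `<=` C & acl C0 e].
Proof.
move=> [G [p [c [Cc pe fin]]]]; exists (range_tup c); split.
- exact: finite_range_tup.
- exact/range_tup_sub.
- by exists G, p, c; split=> //; exact: tup_in_range.
Qed.

Lemma acl_finite_set C A : finite_set A -> A `<=` acl C ->
  exists C0, [/\ finite_set C0, C0 `<=` C & A `<=` acl C0].
Proof.
move: A; apply: finite_set_ind => [_|x A _ IH sub].
  by exists set0; split; [exact: finite_set0| |].
have [|C1 [f1 s1 A1]] := IH; first by apply: subset_trans sub; exact: subsetUr.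
have [|C2 [f2 s2 A2]] := @acl_finite C x; first by apply: sub; left.
exists (C1 `|` C2); split; first by rewrite finite_setU.
  by rewrite subUset.
move=> y [->|Ay]; first by apply: acl_mono A2; exact: subsetUr.
by apply: acl_mono (A1 _ Ay); exact: subsetUl.
Qed.

Lemma aut_acl_sub C g : automorphism g ->
  emap g @` acl C `<=` acl (emap g @` C).
Proof.
move=> ag _ [[s x] [G [p [c [Cc px fin]]]] <-] /=.
exists G, p, (tmap g c); split; first exact: tup_in_tmap.
  by have := px; rewrite (aut_elementary ag) tmap_tcons.
apply: sub_finite_set (finite_image (g s) fin) => y /= py.
have [ei si] := ag; have [z zy] := si s y; exists z => //=.
by rewrite (aut_elementary ag) tmap_tcons zy.
Qed.

Lemma aut_acl C g : automorphism g -> emap g @` acl C = acl (emap g @` C).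
Proof.
move=> ag; apply/seteqP; split; first exact: aut_acl_sub.
have [h [ah gh hg]] := aut_inv ag.
move=> e acle; exists (emap h e); last by case: e acle => s x _; rewrite /emap /= gh.
have -> : C = emap h @` (emap g @` C).
  rewrite emap_comp; symmetry; apply: emap_fix => -[s x] _.
  by rewrite /emap /= hg.
by apply: (aut_acl_sub ah); exists e.
Qed.

Lemma aut_acl_fixes C g : automorphism g -> fixes C g -> emap g @` acl C = acl C.
Proof. by move=> ag fg; rewrite aut_acl // (emap_fix fg). Qed.

Definition aut_orbit C (e : elt M) : set (elt M) :=
  [set e' | exists g, [/\ automorphism g, fixes C g & e' = emap g e]].

Lemma aut_orbit_refl C e : aut_orbit C e e.
Proof.
exists (fun _ x => x); split; [exact: aut_id|by case|by case: e].
Qed.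

Lemma acl_orbit_finite C e : acl C e -> finite_set (aut_orbit C e).
Proof.
case: e => s x [G [p [c [Cc px fin]]]].
apply: sub_finite_set (finite_image (existT M s) fin).
move=> _ [g [ag fg ->]]; exists (g s x) => //=.
have := px; rewrite (aut_elementary ag) tmap_tcons.
by rewrite (fixes_tmap fg Cc).
Qed.

Section Monster.
Context (K : Type) (hL : small K [set: any_formula L]) (mM : monster K M).

(** If [e] were not algebraic, every formula over [C] that it satisfies would have infinitely many
    solutions, so by saturation its type over [C] would be realised outside the small orbit, while
    homogeneity puts every realisation inside. *)
Lemma small_orbit_acl C e : small K C -> small K (aut_orbit C e) -> acl C e.
Proof.
move=> sC sO; apply: contrapT => ne; case: e ne sO => s x ne sO.
set O := aut_orbit C (existT M s x) in sO.
pose R : set (elt (pairs M M)) := emap (fun s (z : M s) => (z, z) : pairs M M s) @` C.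
pose neq (y : M s) : pformula M s :=
  existT _ [:: s] (FNot (FEq (Var L (@vz S s [:: s])) (Var L (vs s (@vz S s [::])))),
     tcons y (@tnil S M)).
have neqP y z : sat (projT2 (neq y)).1 (tcons z (projT2 (neq y)).2) <-> z <> y by [].
have neq_inj y z : neq y = neq z -> y = z.
  by move=> e; apply: contrapT => /(proj2 (neqP z y)); rewrite -e => /neqP.
pose T := transport_type R x `|` [set neq y | y in [set y | O (existT M s y)]].
have Rdiag G (w : tup (pairs M M) G) : tup_in R w ->
    tmap (@psnd S M M) w = tmap (@pfst S M M) w /\ tup_in C (tmap (@pfst S M M) w).
  move=> /tup_in_emap[a Ca ->]; split=> //; exact: Ca.
have [||Q fQ QT|y yT] := mM.1 (C `|` O) s T.
- exact: (small_setU hL).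
- move=> _ [[G [p [w [-> Rw _]]]]|[y Oy <-]].
    by have [/= -> Cw] := Rdiag _ _ Rw; apply: sub_tup_in Cw; exact: subsetUl.
  by apply: tup_in_tcons; [right|move=> t v; case: (var_nil v)].
- have [|G [p [w [Rw px pQ]]]] :=
    @transport_type_conj _ _ _ _ R s x (Q `&` transport_type R x) (finite_setIl _ fQ).
    exact: subIsetr.
  have [e Cw] := Rdiag _ _ Rw.
  have inf : infinite_set [set y | sat p (tcons y (tmap (@pfst S M M) w))].
    by move=> fin; apply: ne; exists G, p, (tmap (@pfst S M M) w).
  have fin : finite_set (neq @^-1` Q).
    by apply: finite_preimage fQ => y z _ _; exact: neq_inj.
  have [y [py nQ]] := infinite_setN0 (infinite_setD inf fin).
  exists y => phi Qphi; have [Tphi|[z Oz zphi]] := QT _ Qphi.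
    by apply: pQ => //; rewrite e.
  by rewrite -zphi; apply/neqP => yz; apply: nQ; rewrite yz /= zphi.
have pR : pelem (R `|` [set existT (pairs M M) s (x, y)]).
  apply: pelem_half => G p w /tup_isolate[G' [w' [r [Rw' ->]]]] /=.
  rewrite -[tmap _ (precomp r _)]/(precomp r (tmap _ _)) -sat_ren tmap_tcons => pq.
  rewrite -[tmap _ (precomp r _)]/(precomp r (tmap _ _)) -sat_ren tmap_tcons.
  apply: (yT (existT _ G' (ren_formula p r, tmap (@psnd S M M) w'))).
  by left; exists G', (ren_formula p r), w'.
have [|g [ag gR]] := pelem_aut mM.2 pR.
  apply: small_sub (small_setU hL sC (small_finite hL (finite_set1 (existT M s x)))).
  by move=> _ [_ [[z Cz <-]|->] <-]; [left; case: z Cz|right].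
have Oy : O (existT M s y).
  exists g; split=> //; last by rewrite /emap /= (gR s x y) //; right.
  move=> [t z] Cz; rewrite /emap /= (gR t z z) //.
  by left; exists (existT M t z).
have /neqP := yT (neq y) (or_intror (ex_intro2 _ _ y Oy erefl)).
exact.
Qed.

(** Orbits avoid any combination of formulas: the orbit over [C] of a point of [acl (acl C)] stays
    in that set, which is small. *)
Lemma acl_idem C : small K C -> acl (acl C) = acl C.
Proof.
move=> sC; apply/seteqP; split; last exact: acl_ext.
move=> e acle; apply: small_orbit_acl => //.
apply: small_sub (small_acl hL (small_acl hL sC)).
move=> _ [g [ag fg ->]]; have E := aut_acl_fixes ag fg.
by have := aut_acl (acl C) ag; rewrite E => <-; exists e.
Qed.

Lemma acl_sub C D : small K D -> C `<=` acl D -> acl C `<=` acl D.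
Proof. by move=> sD CD; rewrite -(acl_idem sD); exact: acl_mono. Qed.

Definition closed_set D := forall f (a : tup M (fdom f)), tup_in D a ->
  D (existT M (fcod f) (ifn (inter M) a)).

Lemma acl_closed C : small K C -> closed_set (acl C).
Proof.
move=> sC f a Ca.
apply: (@acl_sub (range_tup a) C) => //; first exact/range_tup_sub.
exists (fdom f), (FEq (Var L (@vz S _ _)) (@App S L _ f (fun u v => Var L (vs _ v)))), a.
split=> //; first exact: tup_in_range.
by apply: sub_finite_set (finite_set1 (ifn (inter M) a)).
Qed.

End Monster.

(** * Elementary substructures *)

(** The Tarski-Vaught test for elementary substructures. *)
Definition tv_closed D := forall s G (p : formula L (s :: G)) c, tup_in D c ->
  (exists x, sat p (tcons x c)) -> exists x, D (existT M s x) /\ sat p (tcons x c).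

Lemma tv_closed_fun D : tv_closed D -> closed_set D.
Proof.
move=> tv f a Da.
have [|y [Dy /= <-//]] := tv _ _
  (FEq (Var L (@vz S _ _)) (@App S L _ f (fun u v => Var L (vs _ v)))) a Da.
by exists (ifn (inter M) a).
Qed.

Lemma tup_in_bigcup (X : nat -> set (elt M)) : (forall n, X n `<=` X n.+1) ->
  forall G (c : tup M G), tup_in (\bigcup_n X n) c -> exists n, tup_in (X n) c.
Proof.
move=> XS; have mono m n : (m <= n)%N -> X m `<=` X n.
  by move=> /subnK <-; elim: (n - m)%N => //= k IH e /IH; exact: XS.
elim=> [|s G IH] c Xc; first by exists 0 => s v; case: (var_nil v).
have [t v|n Xn] := IH (ttail c); first exact: Xc.
have [m _ Xm] := Xc s (@vz S s G).
exists (maxn m n); rewrite (tup_eta c); apply: tup_in_tcons.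
  exact: mono (leq_maxl _ _) _ Xm.
by move=> t v; exact: mono (leq_maxr _ _) _ (Xn t v).
Qed.

Lemma lowenheim_skolem K (hL : small K [set: any_formula L]) X : small K X ->
  exists D, [/\ X `<=` D, small K D & tv_closed D].
Proof.
move=> sX; have [Z [iZ sZ LZ XZ _]] := small_bound hL sX sX.
(* One witness per formula and parameters; the value is [None] when there is none, since the sort
   may be empty. *)
pose W s G (p : formula L (s :: G)) (c : tup M G) : option (M s) :=
  if pselect (exists x, sat p (tcons x c)) is left e then Some (projT1 (cid e))
  else None.
pose F s G (p : formula L (s :: G)) (c : tup M G) : set (elt M) :=
  [set e | exists y, W s G p c = Some y /\ e = existT M s y].
pose next C := C `|` [set e | exists s G (p : formula L (s :: G)) c,
  tup_in C c /\ F s G p c e].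
pose X_ n := iter n next X.
have XZ_ n : X_ n #<= Z.
  elim: n => //= n IH; apply: card_setU_le => //.
  apply: card_params_le => // s G p c _; apply: card_finite_le => //.
  case e : (W s G p c) => [y|].
    apply: sub_finite_set (finite_set1 (existT M s y)).
    by move=> phi [z []]; rewrite e => -[->] ->.
  by apply: sub_finite_set (@finite_set0 _) => phi [z []]; rewrite e.
exists (\bigcup_n X_ n); split; first by move=> e Xe; exists 0.
  by apply: small_le sZ; apply: (card_bigcup_le iZ) => [|n _];
    [exact: card_nat_le|exact: XZ_].
move=> s G p c /tup_in_bigcup[|n Xc pc]; first by move=> n; exact: subsetUl.
case e : (W s G p c) => [y|]; last first.
  by move: e; rewrite /W; case: pselect.
exists y; split.
  by exists n.+1 => //; right; exists s, G, p, c; split=> //; exists y.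
by move: e; rewrite /W; case: pselect => // h [<-]; case: cid.
Qed.

(** A solution outside [D] satisfies the formula and differs from its finitely many solutions in
    [D]. This is again a condition over [D], so the test yields a solution in [D] different from all
    of those. *)
Lemma tv_closed_acl D : tv_closed D -> acl D `<=` D.
Proof.
move=> tv [s x] [G [p [c [Dc px fin]]]]; apply: contrapT => nD.
pose R : set (elt (pairs M M)) := emap (fun s (z : M s) => (z, z) : pairs M M s) @` D.
pose neq (y : M s) : pformula M s :=
  existT _ [:: s] (FNot (FEq (Var L (@vz S s [:: s])) (Var L (vs s (@vz S s [::])))),
     tcons y (@tnil S M)).
pose Q := existT _ G (p, c) |`
  [set neq y | y in [set y | sat p (tcons y c)] `&` [set y | D (existT M s y)]].
have diag G' (c' : tup M G') : tup_in D c' -> exists w : tup (pairs M M) G',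
    [/\ tup_in R w, tmap (@psnd S M M) w = c' & tmap (@pfst S M M) w = c'].
  move=> Dc'; exists (fun s v => (c' s v, c' s v)); split=> // t v.
  by exists (existT M t (c' t v)).
have [||G1 [p1 [w [Rw p1x p1Q]]]] := @transport_type_conj _ _ _ _ R s x Q.
- by rewrite finite_setU; split; [exact: finite_set1|apply: finite_image; exact: finite_setIl].
- move=> phi [->|[y [py Dy] <-]].
    have [w [Rw w1 w2]] := diag _ _ Dc.
    by exists G, p, w; rewrite w1 w2.
  have [|w [Rw w1 w2]] := diag [:: s] (tcons y (@tnil S M)).
    by apply: tup_in_tcons => // t v; case: (var_nil v).
  eexists _, _, w; rewrite w1 w2; split=> //.
  by move=> /= xy; apply: nD; rewrite xy.
have [w' Dw' ew] := tup_in_emap Rw.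
have [y [Dy p1y]] : exists y, D (existT M s y) /\ sat p1 (tcons y w').
  by apply: tv => //; exists x; move: p1x; rewrite ew.
have Qy : realizes y Q by apply: p1Q; rewrite ew.
have py : sat p (tcons y c) by apply: (Qy (existT _ G (p, c))); left.
have : sat (projT2 (neq y)).1 (tcons y (projT2 (neq y)).2).
  by apply: Qy; right; exists y.
exact.
Qed.

End Acl.

Section SameType.
Context (S : Type) (L : language S) (K : Type) (M : structure L).
Context (hL : small K [set: any_formula L]).

Lemma same_type_aut (C A' A : set (elt M)) : strongly_homogeneous K M ->
  small K A -> small K C -> same_type C A' A ->
  exists g : forall s, M s -> M s,
    [/\ automorphism g, fixes C g & emap g @` A = A'].
Proof.
move=> hom sA sC [h [eh hC <-]].
have [g [ag gh]] := hom _ h (small_setU hL sA sC) eh.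
exists g; split=> //; first by move=> e Ce; rewrite gh; [exact: hC|right].
by apply: emap_eq => e Ae; apply: gh; left.
Qed.

Lemma aut_same_type (C A : set (elt M)) (g : forall s, M s -> M s) :
  automorphism g -> fixes C g -> same_type C (emap g @` A) A.
Proof.
by move=> ag gC; exists g; split=> // G p a _; exact: aut_elementary.
Qed.

End SameType.

(** * Substructures, graphs of embeddings and copies in an ambient type *)

Section Substructures.
Context (S : Type) (L : language S).
Implicit Types M N : structure L.

Definition sub_struct M D (cl : closed_set (M := M) D) : structure L :=
  @Structure S L (subsort D)
    (@Interp S L (subsort D)
      (fun f a => exist _ (ifn (inter M) (fun s v => proj1_sig (a s v)))
                    (cl f _ (fun s v => proj2_sig (a s v))))
      (fun r a => irel (inter M) (fun s v => proj1_sig (a s v)))).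

Definition sub_incl M D (cl : closed_set (M := M) D) s (x : sub_struct cl s) : M s :=
  proj1_sig x.

Lemma sub_incl_embedding M D (cl : closed_set (M := M) D) : embedding (@sub_incl M D cl).
Proof. by split=> // s [x Dx] [y Dy] /= xy; exact: eq_exist. Qed.

Lemma sub_incl_in M D (cl : closed_set (M := M) D) G (a : tup (sub_struct cl) G) :
  tup_in D (tmap (@sub_incl M D cl) a).
Proof. by move=> s v; rewrite /tmap /sub_incl; case: (a s v). Qed.

Lemma sub_elementary M D (cl : closed_set (M := M) D) : tv_closed D ->
  elementary_on setT (@sub_incl M D cl).
Proof.
move=> tv G p a _; have e := sub_incl_embedding cl.
elim: p a => {G} [G|G s t u|G f b|G p IHp q IHq|G s p IH] a.
- by [].
- exact: (embedding_qf e).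
- exact: (embedding_qf e).
- by rewrite /= IHp IHq.
- split=> /= h x; last by rewrite IH tmap_tcons; exact: h.
  apply: contrapT => nx.
  have [||y [Dy ny]] := tv _ _ (FNot p) (tmap (@sub_incl M D cl) a).
  + exact: sub_incl_in.
  + by exists x.
  + by apply: ny; have := h (exist _ y Dy); rewrite IH tmap_tcons.
Qed.

Lemma elementary_tv_closed M N (h : forall s, N s -> M s) :
  elementary_on setT h -> tv_closed (M := M) (emap h @` setT).
Proof.
move=> eh s G p c /tup_in_emap[a _ ->] ex.
have aT : tup_in setT a by [].
have /sat_ex[x px] : sat (FEx p) a by apply/(eh _ _ _ aT)/sat_ex.
exists (h s x); split; first by exists (existT N s x).
by rewrite -tmap_tcons; apply/eh.
Qed.

End Substructures.

Arguments sub_elementary [S L M D] cl _ [G] p [a] _.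

Section MorePelem.
Context (S : Type) (L : language S).
Implicit Types M N P : structure L.

Definition graph2 P M N (h : forall s, P s -> M s) (k : forall s, P s -> N s) :
    set (elt (pairs M N)) :=
  emap (fun s x => (h s x, k s x) : pairs M N s) @` [set: elt P].

Lemma graph2_in P M N (h : forall s, P s -> M s) (k : forall s, P s -> N s) s x :
  graph2 h k (existT (pairs M N) s (h s x, k s x)).
Proof. by exists (existT P s x). Qed.

Lemma pqf_graph2 P M N (h : forall s, P s -> M s) (k : forall s, P s -> N s) :
  embedding h -> embedding k -> pqf (graph2 h k).
Proof.
move=> eh ek G p w qp /tup_in_emap[a _ ->].
rewrite -[tmap _ (tmap _ a)]/(tmap h a) -[X in _ <-> sat p X]/(tmap k a).
by rewrite -(embedding_qf eh) // -(embedding_qf ek).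
Qed.

Lemma pelem_graph2 P M N (h : forall s, P s -> M s) (k : forall s, P s -> N s) :
  elementary_on setT h -> elementary_on setT k -> pelem (graph2 h k).
Proof.
move=> eh ek G p w /tup_in_emap[a _ ->].
rewrite -[tmap _ (tmap _ a)]/(tmap h a) -[X in _ <-> sat p X]/(tmap k a).
have aT : tup_in setT a by [].
by rewrite -(eh _ _ _ aT) -(ek _ _ _ aT).
Qed.

Lemma pelem_pqf M N (R : set (elt (pairs M N))) : pelem R -> pqf R.
Proof. by move=> pR G p w _; exact: pR. Qed.

Definition pcomp M N P (R1 : set (elt (pairs M N))) (R2 : set (elt (pairs N P))) :
    set (elt (pairs M P)) :=
  [set e | exists y, R1 (existT (pairs M N) (projT1 e) ((projT2 e).1, y)) /\
                     R2 (existT (pairs N P) (projT1 e) (y, (projT2 e).2))].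

Lemma tup_in_pcomp M N P (R1 : set (elt (pairs M N))) (R2 : set (elt (pairs N P)))
    G (w : tup (pairs M P) G) : tup_in (pcomp R1 R2) w ->
  exists w1 w2, [/\ tup_in R1 w1, tup_in R2 w2,
    tmap (@pfst S M N) w1 = tmap (@pfst S M P) w,
    tmap (@psnd S M N) w1 = tmap (@pfst S N P) w2 &
    tmap (@psnd S N P) w2 = tmap (@psnd S M P) w].
Proof.
move=> Rw; pose y s v := projT1 (cid (Rw s v)).
have yP s v := projT2 (cid (Rw s v)).
exists (fun s v => ((w s v).1, y s v)), (fun s v => (y s v, (w s v).2)).
by split=> // s v; have [] := yP s v.
Qed.

Lemma pelem_comp M N P (R1 : set (elt (pairs M N))) (R2 : set (elt (pairs N P))) :
  pelem R1 -> pelem R2 -> pelem (pcomp R1 R2).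
Proof.
move=> p1 p2 G p w /tup_in_pcomp[w1 [w2 [R1w R2w <- e <-]]].
by rewrite (p1 _ _ _ R1w) e; exact: p2.
Qed.

Lemma pqf_comp M N P (R1 : set (elt (pairs M N))) (R2 : set (elt (pairs N P))) :
  pqf R1 -> pqf R2 -> pqf (pcomp R1 R2).
Proof.
move=> p1 p2 G p w qp /tup_in_pcomp[w1 [w2 [R1w R2w <- e <-]]].
by rewrite (p1 _ _ _ qp R1w) e; exact: p2.
Qed.

Lemma embedding_surj_inv M N (h : forall s, M s -> N s) : embedding h ->
  (forall s y, exists x, h s x = y) ->
  exists k : forall s, N s -> M s, [/\ embedding k, forall s y, h s (k s y) = y &
    forall s x, k s (h s x) = x].
Proof.
move=> eh sh; have [inj _ _] := eh.
pose k s y := projT1 (cid (sh s y)).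
have hk s y : h s (k s y) = y by rewrite /k; case: cid.
by exists k; split=> // [|s x]; [exact: embedding_inv hk|apply: inj].
Qed.

Lemma sub_struct_range M D (cl : closed_set (M := M) D) X (j : forall s, M s -> X s) :
  emap (fun s x => j s (sub_incl (cl := cl) x)) @` setT = emap j @` D.
Proof.
apply/seteqP; split=> [_ [[s [x Dx]] _ <-]|_ [[s x] Dx <-]].
  by exists (existT M s x).
by exists (existT (sub_struct cl) s (exist _ x Dx)).
Qed.

Lemma substr_embeddings (X : S -> Type) (N N' : structure_in L X) M
    (k : forall s, M s -> N s) (k' : forall s, M s -> N' s) :
  embedding k -> (forall s y, exists x, k s x = y) -> embedding k' ->
  (forall s x, Defs.incl (k s x) = Defs.incl (k' s x)) -> substr N N'.
Proof.
move=> ek sk ek' kk'; have [l [el kl lk]] := embedding_surj_inv ek sk.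
exists (fun s y => k' s (l s y)); split; last exact: embedding_comp.
by move=> s y; rewrite -kk' kl.
Qed.

Lemma incl_inj (X : S -> Type) (N : structure_in L X) s :
  injective (@Defs.incl S L X N s).
Proof. exact: proj1_sig_inj. Qed.

(** Derivation-likeness speaks of structures whose universe is a subset of [U0]; an injection
    replaces an abstract structure by an isomorphic one of this kind. *)
Lemma image_struct M (X : S -> Type) (j : forall s, M s -> X s) :
  (forall s, injective (j s)) ->
  exists (N : structure_in L X) (k : forall s, M s -> N s),
    [/\ embedding k, forall s y, exists x, k s x = y,
        forall s x, Defs.incl (k s x) = j s x & dom N = emap j @` setT].
Proof.
move=> inj; pose D := emap j @` [set: elt M].
have DP s (y : subsort D s) : exists x, j s x = proj1_sig y.
  have key z : D z -> exists x, j (projT1 z) x = projT2 z.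
    by move=> [[t x] _ <-]; exists x.
  exact: key (proj2_sig y).
pose inv s y := projT1 (cid (DP s y)).
have invK s y : j s (inv s y) = proj1_sig y by rewrite /inv; case: cid.
have Dj s x : D (existT X s (j s x)) by exists (existT M s x).
pose k s x : subsort D s := exist (fun y => D (existT X s y)) (j s x) (Dj s x).
have kK s x : inv s (k s x) = x by apply: inj; rewrite invK.
pose N := @StructureIn S L X D (@Interp S L (subsort D)
  (fun f a => k _ (ifn (inter M) (fun s v => inv s (a s v))))
  (fun r a => irel (inter M) (fun s v => inv s (a s v)))).
exists N, k; split=> //.
- split=> [s x y e|f a|r a].
  + by rewrite -(kK s x) e kK.
  + congr (k _ (ifn _ _)); apply: tup_ext => s v; rewrite /tmap.
    by rewrite -[LHS](kK s).
  + suff {1}-> : a = (fun s v => inv s (k s (a s v))) by [].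
    by apply: tup_ext => s v; rewrite kK.
- move=> s y; exists (inv s y); apply: proj1_sig_inj => /=; exact: invK.
Qed.

End MorePelem.

(** * Reducts *)

Section Lift.
Context (S : Type) (L : language S) (L0 : sublanguage L).
Implicit Types M N : structure L.

Definition lred M : structure L0 := Structure (reduct_interp L0 (inter M)).

Lemma eval_lift M G s (t : term L0 G s) (a : tup M G) :
  eval a (lift_term t) = @eval S L0 (lred M) G a s t.
Proof.
by elim: t => //= f b IH; congr (ifn _ _); apply: tup_ext => u v; exact: IH.
Qed.

Lemma sat_lift M G (p : formula L0 G) (a : tup M G) :
  sat (lift_formula p) a <-> @sat S L0 (lred M) G p a.
Proof.
elim: p a => {G} [G|G s t u|G f b|G p IHp q IHq|G s p IH] a //=.
- by rewrite !eval_lift.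
- suff -> : (fun u v => eval a (lift_term (b u v))) =
            (fun u v => @eval S L0 (lred M) G a _ (b u v)) by [].
  by apply: tup_ext => u v; exact: eval_lift.
- by rewrite IHp IHq.
- by split=> h x; apply/IH/h.
Qed.

Lemma qfree_lift G (p : formula L0 G) : qfree p -> qfree (lift_formula p).
Proof. by elim: p => //= G' p IHp q IHq [/IHp ? /IHq]. Qed.

Lemma embedding_lred M N (h : forall s, M s -> N s) :
  embedding h -> @embedding S L0 (lred M) (lred N) h.
Proof. by case=> h1 h2 h3; split=> // [f a|r a]; [exact: h2|exact: h3]. Qed.

Lemma models_lred M (T0 : theory L0) (T : theory L) : subtheory T0 T ->
  models M T -> models (lred M) T0.
Proof. by move=> sT MT p pT; apply/sat_lift/MT/sT. Qed.

(** Quantifier-free agreement in [M] and [N] becomes full elementarity in the ambient models of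
    [T0]. *)
Lemma pqf_lred (T0 : theory L0) (U V : structure L0) M N
    (j : forall s, M s -> U s) (k : forall s, N s -> V s)
    (R : set (elt (pairs M N))) :
  quantifier_elimination T0 -> models U T0 -> models V T0 ->
  @embedding S L0 (lred M) U j -> @embedding S L0 (lred N) V k -> pqf R ->
  @pelem S L0 U V (emap (fun s z => (j s z.1, k s z.2)) @` R).
Proof.
move=> qe UT VT ej ek qR; apply: qe_pelem qe UT VT _.
move=> G p w qp /tup_in_emap[w' Rw' ->].
have := qR _ (lift_formula p) w' (qfree_lift qp) Rw'.
rewrite !sat_lift (embedding_qf ej) // (embedding_qf ek) //.
Qed.

End Lift.

(** * Amalgams provided by a derivation-like theory *)

Section Amalgam.
Context (S : Type) (L : language S) (L0 : sublanguage L) (K : Type).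
Context (hL : small K [set: any_formula L]).
Context (hL0 : small K [set: any_formula L0]).
Context (T0 : theory L0) (T Tp : theory L) (T0_qe : quantifier_elimination T0).
Context (U0 : structure L0) (U0_model : models U0 T0) (U0_monster : monster K U0).
Context (ind0 : ternary U0).
Context (T_dl : derivation_like K ind0 T).
Context (T_Tp : T `<=` Tp) (Tp_mc : model_companion T Tp).
Context (Up : structure_in L U0) (Up_model : models Up Tp) (Up_monster : monster K Up).
Context (Up_U0 : substr_of (reduct L0 Up)).

Let i := @Defs.incl S L U0 Up.
Local Notation ii D := (emap i @` D).

Lemma UpT : models Up T.
Proof. by move=> p /T_Tp; exact: Up_model. Qed.

Lemma i_embedding : @embedding S L0 (lred L0 Up) U0 i.
Proof. exact: Up_U0. Qed.

Lemma i_inj s : injective (i (s := s)).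
Proof. exact: incl_inj. Qed.

Lemma ii_inj : injective (emap i).
Proof. exact: emap_inj i_inj. Qed.

(** Quantifier elimination of [T0] makes the algebraicity over [C] of an element
    of [Up], as computed in [U0], visible in [Up]. *)
Lemma acl0_acl (C : set (elt Up)) e : acl (ii C) (emap i e) -> acl C e.
Proof.
case: e => s x [G [p [_ [/tup_in_emap[c Cc ->] px fin]]]].
have [q [qq pq]] := T0_qe p.
have E y : sat (lift_formula q) (tcons y c) <-> sat p (tcons (i y) (tmap i c)).
  rewrite sat_lift (pq _ U0_model) -tmap_tcons.
  exact: (@embedding_qf S L0 (lred L0 Up) U0 i i_embedding).
exists G, (lift_formula q), c; split=> //; first exact/E.
have -> : [set y | sat (lift_formula q) (tcons y c)] =
          i (s := s) @^-1` [set y | sat p (tcons y (tmap i c))].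
  by apply/seteqP; split=> y /E.
by apply: finite_preimage fin => y z _ _; exact: i_inj.
Qed.

Lemma fixes_i (B : set (elt Up)) (rho : forall s, U0 s -> U0 s) s (x : Up s) :
  fixes (ii B) rho -> B (existT Up s x) -> rho s (i x) = i x.
Proof.
move=> frho Bx; apply: existT_inj (frho (existT U0 s (i x)) _).
by exists (existT Up s x).
Qed.

Lemma image_lred (M : structure L) (j : forall s, M s -> U0 s) :
  @embedding S L0 (lred L0 M) U0 j ->
  exists (N : structure_in L U0) (k : forall s, M s -> N s),
    [/\ embedding k, forall s y, exists x, k s x = y,
        forall s x, Defs.incl (k s x) = j s x, dom N = emap j @` setT &
        substr_of (reduct L0 N)].
Proof.
move=> ej; have [jinj _ _] := ej.
have [N [k [ek sk kj dN]]] := @image_struct S L M U0 j jinj.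
exists N, k; split=> //; have [l [el kl lk]] := embedding_surj_inv ek sk.
rewrite /substr_of.
suff -> : @Defs.incl S L0 U0 (reduct L0 N) = (fun s y => j s (l s y)).
  exact: (@embedding_comp S L0 (lred L0 N) (lred L0 M) U0 l j (embedding_lred _ el) ej).
apply: functional_extensionality_dep => s.
by apply: functional_extensionality_dep => y; rewrite -kj kl.
Qed.

Definition acl0_closed (C : set (elt Up)) := forall e, acl (ii C) (emap i e) -> C e.

(** * Amalgamation of [A] with the copy of [D] moved by [rho] *)

Section Base.
Context (A C D : set (elt Up)).
Context (clA : closed_set A) (clC : closed_set C) (clD : closed_set D).
Context (CA : C `<=` A) (CD : C `<=` D).
Context (sA : small K A) (sC : small K C) (sD : small K D).
Context (C0 : acl0_closed C).
Context (rho : forall s, U0 s -> U0 s) (arho : automorphism rho).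
Context (frho : fixes (ii C) rho).
Context (AD : ind0 (ii A) (ii C) (emap rho @` (ii D))).

Let j (E : set (elt Up)) (clE : closed_set E) s (x : sub_struct clE s) : U0 s :=
  i (sub_incl x).

Let j_embedding (E : set (elt Up)) (clE : closed_set E) :
  @embedding S L0 (lred L0 (sub_struct clE)) U0 (@j E clE).
Proof.
exact: (@embedding_comp S L0 (lred L0 (sub_struct clE)) (lred L0 Up) U0 _ i
  (embedding_lred _ (sub_incl_embedding clE)) i_embedding).
Qed.

Let sub_univ (E : set (elt Up)) (clE : closed_set E) : models (sub_struct clE) (univ_part T).
Proof.
exact: models_univ (sub_incl_embedding clE) (models_univ_part UpT).
Qed.

Let sub_sub (E F : set (elt Up)) (clE : closed_set E) (clF : closed_set F) (EF : E `<=` F) :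
  exists h : forall s, sub_struct clE s -> sub_struct clF s,
    embedding h /\ forall s x, sub_incl (h s x) = sub_incl x.
Proof.
exists (fun s (x : sub_struct clE s) => exist _ (proj1_sig x) (EF _ (proj2_sig x))).
split=> //; apply: (embedding_cancel (sub_incl_embedding clF)).
exact: (sub_incl_embedding clE).
Qed.

(** [A'] and [C'] copy substructures of [Up], whereas [D'] bears the L-structure of [D] transported
    by [rho] and need not lie in [Up]. That [D'] meets the closure of the base only in the base is
    seen by moving back with the inverse of [rho], which also fixes [C]. *)
Let setting : exists A' C' D' : structure_in L U0,
  exists (kA : forall s, sub_struct clA s -> A' s) (kD : forall s, sub_struct clD s -> D' s),
  [/\ [/\ dom A' = ii A, dom C' = ii C & dom D' = emap rho @` (ii D)],
    [/\ models A' (univ_part T), models D' (univ_part T) & models C' (univ_part T)],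
    [/\ substr C' A', substr C' D', substr_of (reduct L0 A') &
        substr_of (reduct L0 D')],
    acl (dom C') `&` dom A' = dom C' /\ acl (dom C') `&` dom D' = dom C' &
    [/\ embedding kA, forall s x, Defs.incl (kA s x) = j x, embedding kD,
        forall s x, Defs.incl (kD s x) = rho (j x) &
        (forall s y, exists x, kA s x = y) /\ (forall s y, exists x, kD s x = y)]].
Proof.
have [A' [kA [eA surA iA dA rA]]] := image_lred (j_embedding clA).
have [C' [kC [eC surC iC dC rC]]] := image_lred (j_embedding clC).
have erho := @embedding_comp S L0 (lred L0 (sub_struct clD)) U0 U0 _ _
  (j_embedding clD) (arho.1).
have [D' [kD [eD surD iD dD rD]]] := image_lred erho.
have dA' : dom A' = ii A by rewrite dA; exact: sub_struct_range.
have dC' : dom C' = ii C by rewrite dC; exact: sub_struct_range.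
have dD' : dom D' = emap rho @` (ii D).
  by rewrite dD emap_comp -(sub_struct_range clD).
have univ (N : structure_in L U0) (E : set (elt Up)) (clE : closed_set E)
    (k : forall s, sub_struct clE s -> N s) : embedding k ->
    (forall s y, exists x, k s x = y) -> models N (univ_part T).
  move=> ek sk; have [l [el _ _]] := embedding_surj_inv ek sk.
  exact: models_univ el (sub_univ clE).
exists A', C', D', kA, kD; split=> //.
- by split; [exact: univ eA surA|exact: univ eD surD|exact: univ eC surC].
- have [h [eh hi]] := sub_sub clC clA CA.
  have [h' [eh' hi']] := sub_sub clC clD CD.
  split=> //.
    apply: (substr_embeddings eC surC (embedding_comp eh eA)) => s x.
    by rewrite iA iC /j hi.
  apply: (substr_embeddings eC surC (embedding_comp eh' eD)) => s x.
  by rewrite iD iC /j hi' (fixes_i frho (proj2_sig x)).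
- rewrite dC' dA' dD'; split; apply/seteqP; split.
  + by move=> e0 [+ [e Ae ee]]; rewrite -ee => ac; exists e => //; exact: C0.
  + by move=> e Ce; split; [exact: acl_ext|exact: image_subset CA _ Ce].
  + move=> e0 [+ [_ [e De <-] ee]]; rewrite -ee => ac'.
    have ac : acl (ii C) (emap i e).
      have [l [al rl lr]] := aut_inv arho.
      have fl : fixes (ii C) l by apply: fixes_inv frho lr.
      rewrite -(aut_acl_fixes al fl); eexists; first exact: ac'.
      by case: e {De ee ac'} => s x; rewrite /emap /= lr.
    have Ce := C0 ac; rewrite frho; first by exists e.
    by exists e.
  + move=> e [x Cx <-]; split; first by apply: acl_ext; exists x.
    exists (emap i x); first by exists x => //; exact: CD.
    by rewrite frho //; exists x.
Qed.

Definition amalgam (N : structure_in L U0)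
    (kA : forall s, sub_struct clA s -> N s) (kD : forall s, sub_struct clD s -> N s) :=
  [/\ models N T, substr_of (reduct L0 N), embedding kA /\ embedding kD,
    forall s x, Defs.incl (kA s x) = i (sub_incl x) &
    forall s x, Defs.incl (kD s x) = rho (i (sub_incl x))].

Lemma amalgam_ex : exists N kA kD, @amalgam N kA kD.
Proof.
have [A' [C' [D' [kA [kD [[dA dC dD] [uA uD uC] [CA' CD' rA rD] [aA aD] [eA iA eD iD _]]]]]]]
  := setting.
have [||||[N [NT rN [hA [iA' ehA]] [hD [iD' ehD]]]] _] :=
  @T_dl A' D' C' _ _ _ uA uD uC CA' CD' rA rD aA aD _.
- by rewrite dA; exact: small_image.
- by rewrite dD; do 2 apply: small_image.
- by rewrite dC; exact: small_image.
- by rewrite dA dC dD.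
exists N, (fun s x => hA s (kA s x)), (fun s x => hD s (kD s x)); split=> //.
- by split; exact: embedding_comp.
- by move=> s x; rewrite iA' iA.
- by move=> s x; rewrite iD' iD.
Qed.

(** Both [N1] and [N2] induce on [E] the unique L-structure extending those of
    [A] and [D]. *)
Lemma common_substr N1 kA1 kD1 N2 kA2 kD2 (E : set (elt U0)) (clE : closed_set E) :
  @amalgam N1 kA1 kD1 -> @amalgam N2 kA2 kD2 ->
  ii A `<=` E -> emap rho @` (ii D) `<=` E ->
  E `<=` acl (ii A `|` emap rho @` (ii D)) -> E `<=` dom N1 -> E `<=` dom N2 ->
  exists I : structure_in L U0, [/\ dom I = E, substr I N1 & substr I N2].
Proof.
move=> am1 am2 AE DE Eacl E1 E2.
have [A' [C' [D' [kA [kD [[dA dC dD] [uA uD uC] [CA' CD' rA rD] [aA aD]]]]]]] := setting.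
move=> [eA iA eD iD [surA surD]].
have [||||_ uniq] := @T_dl A' D' C' _ _ _ uA uD uC CA' CD' rA rD aA aD _.
- by rewrite dA; exact: small_image.
- by rewrite dD; do 2 apply: small_image.
- by rewrite dC; exact: small_image.
- by rewrite dA dC dD.
have am N lA lD : @amalgam N lA lD -> [/\ models N T, substr_of (reduct L0 N),
    substr A' N & substr D' N].
  move=> [NT rN [elA elD] ilA ilD]; split=> //.
    by apply: (substr_embeddings eA surA elA) => s x; rewrite ilA iA.
  by apply: (substr_embeddings eD surD elD) => s x; rewrite ilD iD.
pose D0 : structure_in L0 U0 := @StructureIn S L0 U0 E (inter (sub_struct clE)).
have D0U : substr_of D0 by exact: sub_incl_embedding.
have D0g : generated (dom A' `|` dom D') `<=` dom D0.
  move=> e; apply; last exact: clE.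
  by rewrite dA dD subUset.
have D0a (N : structure_in L U0) : E `<=` dom N ->
    dom D0 `<=` acl (dom A' `|` dom D') `&` dom N.
  by move=> EN e Ee; split; [rewrite dA dD; exact: Eacl|exact: EN].
have [I1 [I1N uI1]] := uniq N1 (am _ _ _ am1) D0 D0U D0g (D0a N1 E1).
have [I2 [I2N uI2]] := uniq N2 (am _ _ _ am2) D0 D0U D0g (D0a N2 E2).
(* The structure induced by [N2] meets the conditions that characterise the one induced by [N1]. *)
have e := uI1.2 _ uI2.1.
exists (StructureIn I1); split=> //.
by rewrite e.
Qed.

Lemma small_sub_struct (E : set (elt Up)) (clE : closed_set E) :
  small K E -> small K [set: elt (sub_struct clE)].
Proof.
apply: small_le; apply: (@card_le_rel _ _ _ _ (fun x y => y = emap (@sub_incl _ _ _ _ clE) x)).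
  move=> [s x] _; eexists; split; last reflexivity.
  by case: x.
move=> x x' y _ _ -> /emap_inj; apply=> s.
by have [] := sub_incl_embedding clE.
Qed.

(** Saturation extends the map from the copy of [D] in [N'] back to [D] until it covers the copy of
    [A]; composed with the given map from [A] and [B] into [N'], it yields [g]. The same pairs, read
    in [N], preserve quantifier-free formulas, and quantifier elimination of [T0] yields [tau].
    Elementarity is assumed here because it has two sources: model completeness, or quantifier
    elimination of [Tp]. *)
Lemma transfer (N : structure_in L U0) kA kD (N' : structure L) (e : forall s, N s -> N' s)
    (B : set (elt Up)) :
  @amalgam N kA kD -> embedding e -> B `<=` D ->
  pelem (graph2 (@sub_incl _ _ _ _ clA) (fun s x => e s (kA s x)) `|`
         [set z | exists s x, B (existT Up s (sub_incl x)) /\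
            z = existT (pairs Up N') s (sub_incl x, e s (kD s x))]) ->
  pelem (graph2 (fun s x => e s (kD s x)) (@sub_incl _ _ _ _ clD)) ->
  exists (g : forall s, Up s -> Up s) (tau : forall s, U0 s -> U0 s),
    [/\ automorphism g, fixes B g, automorphism tau,
      forall a, A a -> emap tau (emap i a) = emap i (emap g a) &
      forall d, D d -> emap tau (emap rho (emap i d)) = emap i d].
Proof.
move=> [NT rN [eA eD] iA iD] ee BD; set R1 := _ `|` _ => p1 p2.
have sB : small K B by apply: small_sub sD.
pose ekA s (x : sub_struct clA s) := e s (kA s x).
pose ekD s (x : sub_struct clD s) := e s (kD s x).
have [|R' [RR' pR' R'A]] := pelem_extend (Q := emap ekA @` setT) Up_monster.1 p2.
  apply: (small_setU hL); last by apply: small_image; exact: small_sub_struct.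
  by do 2 apply: small_image; exact: small_sub_struct.
have R'D s (x : sub_struct clD s) :
    R' (existT (pairs N' Up) s (ekD s x, sub_incl x)).
  by apply: RR'; exact: graph2_in.
have p3 := pelem_comp p1 pR'.
have [|g [ag gR]] := pelem_aut Up_monster.2 p3.
  apply: small_sub (small_setU hL sA sB) => _ [[s [x y]] [z [+ _]] <-] /=.
  move=> [[[t a] _] E|[t [a [Ba E]]]].
    left; change (A (existT Up s x)).
    have -> : existT Up s x = existT Up t (sub_incl a).
      exact: (f_equal (emap (@pfst S Up N')) (esym E)).
    exact: (proj2_sig a).
  right; change (B (existT Up s x)).
  have -> // : existT Up s x = existT Up t (sub_incl a).
  exact: (f_equal (emap (@pfst S Up N')) E).
(* A point of [B] goes to its copy under [kD] and comes back to itself. *)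
have gB : fixes B g.
  move=> [s x] Bx; have Dx := BD _ Bx.
  rewrite /emap /= (gR s x x) //; exists (ekD s (exist _ x Dx)); split=> //=.
  by right; exists s, (exist _ x Dx); split.
have gA s (x : sub_struct clA s) :
    R' (existT (pairs N' Up) s (ekA s x, g s (sub_incl x))).
  have [|y Ry] := R'A s (ekA s x); first by exists (existT _ s x).
  rewrite (gR s (sub_incl x) y) //; exists (ekA s x); split=> //.
  by left; exact: graph2_in.
have q4 := pqf_comp (pqf_graph2 (embedding_id N) ee) (pelem_pqf pR').
pose R5 : set (elt (pairs N Up)) :=
  [set z | ((exists s x, z = existT (pairs N Up) s (kA s x, g s (sub_incl x))) \/
     exists s x, z = existT (pairs N Up) s (kD s x, sub_incl x))].
have q5 : pqf R5.
  move=> G p w qp Rw; apply: (q4 _ _ _ qp) => s v.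
  have [[t [x ->]]|[t [x ->]]] := Rw s v.
    exists (ekA t x); split=> //=; first exact: graph2_in.
  by exists (ekD t x); split=> //=; exact: graph2_in.
have p5 := @pqf_lred S L L0 T0 U0 U0 N Up (@Defs.incl S L U0 N) i R5
  T0_qe U0_model U0_model rN i_embedding q5.
have [|tau [atau tauR]] := pelem_aut U0_monster.2 p5.
  apply: (small_sub (B := ii A `|` emap rho @` (ii D))); last first.
    by apply: (small_setU hL); [exact: small_image|do 2 apply: small_image].
  move=> _ [_ [_ [[s [x ->]]|[s [x ->]]] <-] <-] /=; rewrite /emap /= /pfst /=.
    left; exists (existT Up s (sub_incl x)); first exact: (proj2_sig x).
    by rewrite iA.
  right; rewrite iD; exists (existT U0 s (i (sub_incl x))) => //.
  by exists (existT Up s (sub_incl x)) => //; exact: (proj2_sig x).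
exists g, tau; split=> //.
- move=> [s x] Ax; pose a : sub_struct clA s := exist _ x Ax.
  rewrite /emap /= (tauR s (i x) (i (g s x))) //.
  exists (existT (pairs N Up) s (kA s a, g s x)); first by left; exists s, a.
  by rewrite /emap /= iA.
- move=> [s x] Dx; pose d : sub_struct clD s := exist _ x Dx.
  rewrite /emap /= (tauR s (rho (i x)) (i x)) //.
  exists (existT (pairs N Up) s (kD s d, x)); first by right; exists s, d.
  by rewrite /emap /= iD.
Qed.

End Base.

(** * Realising the amalgam inside [Up] *)

Lemma Tp_extension (N : structure L) : models N T ->
  exists (N' : structure L) (e : forall s, N s -> N' s), models N' Tp /\ embedding e.
Proof. by case: Tp_mc => _ + _; exact. Qed.

Lemma conjugate_over_model (M C : set (elt Up)) (rho : forall s, U0 s -> U0 s) :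
  tv_closed M -> closed_set C -> C `<=` M -> small K M -> acl0_closed C ->
  automorphism rho -> fixes (ii C) rho ->
  ind0 (ii M) (ii C) (emap rho @` (ii M)) ->
  exists (g : forall s, Up s -> Up s) (tau : forall s, U0 s -> U0 s),
    [/\ automorphism g, fixes C g, automorphism tau,
      forall a, M a -> emap tau (emap i a) = emap i (emap g a) &
      forall a, M a -> emap tau (emap rho (emap i a)) = emap i a].
Proof.
move=> tvM clC CM sM C0 arho frho ind.
have clM := tv_closed_fun tvM; have sC := small_sub CM sM.
have [N [kA [kD am]]] := amalgam_ex clM clC clM CM CM sM sC sM C0 arho frho ind.
have [NT rN [eA eD] iA iD] := am.
have [N' [e [N'Tp ee]]] := Tp_extension NT.
have subTp : models (sub_struct clM) Tp.
  move=> p /Up_model pT; have aT : tup_in setT (@tnil S (sub_struct clM)) by [].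
  have E := sub_elementary clM tvM p aT; apply/E.
  by rewrite (tup_nil (tmap _ _) (@tnil S Up)).
have elem (k : forall s, sub_struct clM s -> N s) : embedding k ->
    elementary_on setT (fun s x => e s (k s x)).
  move=> ek; have [mc _ _] := Tp_mc; apply: mc => //.
  exact: embedding_comp.
apply: (transfer sM sM am ee CM).
- apply: pelem_sub (pelem_graph2 (sub_elementary clM tvM) (elem _ eA)).
  move=> z [//|[s [x [Cx ->]]]].
  (* Both embeddings of [M] agree on [C], as [rho] fixes it, so the pairs over [C] add nothing to
     the graph. *)
  have -> : kD s x = kA s x; last exact: graph2_in.
  apply: incl_inj; rewrite iA iD.
  exact: fixes_i frho Cx.
- exact: pelem_graph2 (elem _ eD) (sub_elementary clM tvM).
Qed.

Lemma dom_closed (N : structure_in L U0) : substr_of (reduct L0 N) ->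
  closed_set (M := U0) (dom N).
Proof.
move=> [_ eN _] f a Na;
pose b : tup (reduct L0 N) (fdom f) := fun s v => exist _ (a s v) (Na s v).
by have := eN f b => /= <-; exact: (proj2_sig (ifn (inter (reduct L0 N)) b)).
Qed.

Lemma fixes_id (X : set (elt U0)) : fixes X (fun s (x : U0 s) => x).
Proof. by case. Qed.

Lemma emap_idE (X : set (elt U0)) : emap (fun s (x : U0 s) => x) @` X = X.
Proof. exact: emap_fix (@fixes_id X). Qed.

(** With quantifier elimination, the uniqueness clause for the amalgam of [A]
    and [B] makes the type of the conjugate of [A] over [B] the right one. *)
Lemma conjugate_qe (A B C D : set (elt Up)) (rho : forall s, U0 s -> U0 s) :
  quantifier_elimination Tp ->
  closed_set A -> closed_set B -> closed_set C -> closed_set D ->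
  C `<=` A -> C `<=` B -> B `<=` D -> small K A -> small K D -> acl0_closed C ->
  automorphism rho -> fixes (ii B) rho ->
  ind0 (ii A) (ii C) (emap rho @` (ii D)) -> ind0 (ii A) (ii C) (ii B) ->
  exists (g : forall s, Up s -> Up s) (tau : forall s, U0 s -> U0 s),
    [/\ automorphism g, fixes B g, automorphism tau,
      forall a, A a -> emap tau (emap i a) = emap i (emap g a) &
      forall d, D d -> emap tau (emap rho (emap i d)) = emap i d].
Proof.
move=> qe clA clB clC clD CA CB BD sA sD C0 arho frho indD indB.
have CD := subset_trans CB BD; have sC := small_sub CD sD.
have sB := small_sub BD sD.
have frhoC : fixes (ii C) rho by apply: fixes_sub frho; exact: image_subset.
have [N [kA [kD am]]] := amalgam_ex clA clC clD CA CD sA sC sD C0 arho frhoC indD.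
have [NT rN [eA eD] iA iD] := am.
have [N' [e [N'Tp ee]]] := Tp_extension NT.
apply: (transfer sA sD am ee BD); last first.
  apply: (qe_pelem qe N'Tp Up_model); apply: pqf_graph2.
    exact: embedding_comp.
  exact: sub_incl_embedding.
pose kB s (x : sub_struct clB s) : N s := kD s (exist _ (proj1_sig x) (BD _ (proj2_sig x))).
have eB : embedding kB.
  apply: embedding_comp eD; apply: (embedding_cancel (sub_incl_embedding clD)).
  exact: (sub_incl_embedding clB).
have iB s x : Defs.incl (kB s x) = i (sub_incl x).
  by rewrite iD; exact: fixes_i frho (proj2_sig x).
(* With the identity for [rho], both [Up] and [N] amalgamate [A] and [B]: in [N], the set [B] sits
   unmoved because [rho] fixes it. *)
have am1 : @amalgam A B clA clB (fun s x => x) Up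
    (@sub_incl _ _ _ _ clA) (@sub_incl _ _ _ _ clB).
  split=> //; [exact: UpT|split; exact: sub_incl_embedding].
have am2 : @amalgam A B clA clB (fun s x => x) N kA kB by split.
(* An intersection of three sets closed under the functions of L0, hence admissible in clause (ii)
   for both amalgams. *)
pose E := acl (ii A `|` ii B) `&` (dom Up `&` dom N).
have clE : closed_set (M := U0) E.
  move=> f a Ea; split; [|split].
  - apply: (acl_closed hL0 U0_monster) => [|s v]; last by case: (Ea s v).
    by apply: (small_setU hL0); exact: small_image.
  - by apply: (dom_closed Up_U0) => s v; case: (Ea s v) => _ [].
  - by apply: (dom_closed rN) => s v; case: (Ea s v) => _ [].
have indB' : ind0 (ii A) (ii C) (emap (fun s (x : U0 s) => x) @` (ii B)).
  by rewrite emap_idE.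
have AE s x : A (existT Up s x) -> E (existT U0 s (i x)).
  move=> Ax; split; first by apply: acl_ext; left; exists (existT Up s x).
  split; first exact: (proj2_sig x).
  by have := iA s (exist _ x Ax) => /= <-; exact: (proj2_sig (kA _ _)).
have BE s x : B (existT Up s x) -> E (existT U0 s (i x)).
  move=> Bx; split; first by apply: acl_ext; right; exists (existT Up s x).
  split; first exact: (proj2_sig x).
  by have := iB s (exist _ x Bx) => /= <-; exact: (proj2_sig (kB _ _)).
have [|||||I [dI [h [hi eh]] [h' [hi' eh']]]] :=
  common_substr clC CA CB sA sC sB C0 (aut_id U0) (@fixes_id _) indB' clE am1 am2.
- by move=> _ [[s x] Ax <-]; exact: AE.
- by rewrite emap_idE => _ [[s x] Bx <-]; exact: BE.
- by rewrite emap_idE => y [].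
- by move=> y [_ []].
- by move=> y [_ []].
apply: (qe_pelem qe Up_model N'Tp).
have q := pqf_graph2 eh (embedding_comp eh' ee).
have inI s (x : Up s) (n : N s) : i x = Defs.incl n -> E (existT U0 s (i x)) ->
    graph2 h (fun s x => e s (h' s x)) (existT (pairs Up N') s (x, e s n)).
  rewrite -dI => xn Ix; pose z : I s := exist _ (i x) Ix.
  have -> : x = h s z by apply: i_inj; rewrite /i hi.
  have -> : n = h' s z by apply: incl_inj; rewrite hi' -xn.
  exact: graph2_in.
move=> G p w qp Rw; apply: q => // s v.
have [[[t x] _ <-]|[t [x [Bx ->]]]] := Rw s v.
  by apply: inI; [rewrite iA|apply: AE; exact: (proj2_sig x)].
by apply: inI; [rewrite iD (fixes_i frho Bx)|exact: BE].
Qed.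

(** * Full existence, base monotonicity and extension of the induced relation *)

Context (ind0_inv : aut_invariant K ind0).

(** The restriction of [h] to a small set is elementary in the sense of [U0] by quantifier
    elimination of [T0], and homogeneity of [U0] extends it. *)
Lemma aut_lift (h : forall s, Up s -> Up s) (X : set (elt Up)) :
  automorphism h -> small K X ->
  exists tau : forall s, U0 s -> U0 s, automorphism tau /\
    forall e, X e -> emap tau (emap i e) = emap i (emap h e).
Proof.
move=> ah sX.
pose R : set (elt (pairs Up Up)) := emap (fun s x => (x, h s x) : pairs Up Up s) @` X.
have pR : pelem R by move=> G p w /tup_in_emap[a _ ->]; exact: (aut_elementary ah).
have p0 := @pqf_lred S L L0 T0 U0 U0 Up Up i i R
  T0_qe U0_model U0_model i_embedding i_embedding (pelem_pqf pR).
have [|tau [atau tauR]] := pelem_aut U0_monster.2 p0.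
  apply: small_sub (small_image (emap i) sX).
  by move=> _ [_ [_ [[s x] Xx <-] <-] <-]; exists (existT Up s x).
exists tau; split=> // -[s x] Xx; rewrite /emap /= (tauR s (i x) (i (h s x))) //.
by exists (existT (pairs Up Up) s (x, h s x)) => //; exists (existT Up s x).
Qed.

Lemma ind0_aut (tau : forall s, U0 s -> U0 s) A C B A' C' B' :
  automorphism tau -> small K A -> small K C -> small K B ->
  emap tau @` A = A' -> emap tau @` C = C' -> emap tau @` B = B' ->
  ind0 A C B -> ind0 A' C' B'.
Proof. by move=> at_ sA sC sB <- <- <-; exact: ind0_inv. Qed.

Lemma mono_sub base A B C B' : monotonicity K base ind0 -> small K A ->
  small K B -> small K C -> base C -> B' `<=` B -> ind0 A C B -> ind0 A C B'.
Proof.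
move=> mono sA sB sC bC BB; have sB' := small_sub BB sB.
rewrite -(setUidr BB); exact: mono.
Qed.

Lemma aut_image (A : set (elt U0)) (g h : forall s, U0 s -> U0 s) :
  (forall s x, g s (h s x) = x) -> emap g @` (emap h @` A) = A.
Proof.
by move=> gh; rewrite emap_comp; apply: emap_fix => -[s x] _; rewrite /emap gh.
Qed.

Lemma acl0_closed_acl (C : set (elt Up)) : small K C -> acl0_closed (acl C).
Proof.
move=> sC e /acl0_acl; by rewrite (acl_idem hL Up_monster sC).
Qed.

Let acl_sub_model (M C : set (elt Up)) : tv_closed M -> C `<=` M -> acl C `<=` M.
Proof.
by move=> tv CM; apply: subset_trans (tv_closed_acl tv); exact: acl_mono.
Qed.

(** Full existence of [ind0] is applied to an elementary substructure around [A], [B] and [C], so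
    that conjugation over a model is available; both sides are cut down afterwards, the left one
    through symmetry. *)
Lemma full_existence_plus : monotonicity K setT ind0 -> symmetry K setT ind0 ->
  full_existence K ind0 -> full_existence K (ind_plus ind0 Up).
Proof.
move=> mono sym fe A B C sA sB sC.
have [M [XM sM tv]] := lowenheim_skolem hL (small_setU hL (small_setU hL sA sB) sC).
have AM : A `<=` M by move=> e Ae; apply: XM; left; left.
have BM : B `<=` M by move=> e Be; apply: XM; left; right.
have CM : C `<=` M by move=> e Ce; apply: XM; right.
have C1M := acl_sub_model tv CM.
have siM : small K (ii M) by exact: small_image.
have sC1 := small_acl hL sC.
have siC : small K (ii (acl C)) by exact: small_image.
have [M' [st indM']] := fe _ _ _ siM siM siC.
have [sig [asig fsig eM']] := same_type_aut hL0 U0_monster.2 siM siC st.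
(* Moving the independence back by the inverse leaves [M] in place on the left and displaces the
   right-hand copy, as the amalgamation requires. *)
have [rho [arho sr rs]] := aut_inv asig.
have frho : fixes (ii (acl C)) rho := fixes_inv fsig rs.
have ind1 : ind0 (ii M) (ii (acl C)) (emap rho @` (ii M)).
  apply: (ind0_aut arho _ siC siM _ _ _ indM') => //.
  - by rewrite -eM'; do 2 apply: small_image.
  - by rewrite -eM'; exact: aut_image.
  - exact: emap_fix.
have [g [tau [ag fg at_ tg tr]]] := conjugate_over_model tv
  (acl_closed hL Up_monster sC) C1M sM (acl0_closed_acl sC) arho frho ind1.
have ind2 : ind0 (ii (emap g @` M)) (ii (acl C)) (ii M).
  apply: (ind0_aut at_ siM siC _ _ _ _ ind1).
  - by do 2 apply: small_image.
  - by rewrite emap_comp [RHS]emap_comp; apply: emap_eq => e /tg.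
  - rewrite emap_comp; apply: emap_eq => e Ce; have := tg e (C1M _ Ce).
    by rewrite (fg e Ce).
  - by rewrite emap_comp emap_comp; apply: emap_eq => e /tr.
exists (emap g @` A); split.
  by apply: aut_same_type => //; apply: fixes_sub fg; exact: acl_ext.
rewrite /ind_plus -/i.
have gC : emap g @` C = C by apply: emap_fix; apply: fixes_sub fg; exact: acl_ext.
have -> : acl (emap g @` A `|` C) = emap g @` acl (A `|` C).
  by rewrite aut_acl // image_setU gC.
have sgM : small K (ii (emap g @` M)) by do 2 apply: small_image.
apply: (mono_sub mono _ siM) => //.
- by do 2 apply: small_image; apply: (small_acl hL); exact: (small_setU hL).
- by apply: image_subset; apply: acl_sub_model => //; rewrite subUset.
apply: (sym _ _ _) => //.
  by do 2 apply: small_image; apply: (small_acl hL); exact: (small_setU hL).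
apply: (mono_sub mono siM sgM) => //.
  apply: image_subset; apply: image_subset.
  by apply: acl_sub_model => //; rewrite subUset.
exact: (sym _ _ _).
Qed.

Lemma acl_of_acl0_closed (D : set (elt Up)) :
  monotonicity K setT ind0 -> full_existence K ind0 ->
  closed_set D -> small K D -> acl0_closed D -> acl D `<=` D.
Proof.
move=> mono fe clD sD D0 e ae; apply: contrapT => nDe.
set E := aut_orbit D e; have fE : finite_set E := acl_orbit_finite ae.
have sE := small_finite hL fE.
have [M [XM sM tv]] := lowenheim_skolem hL (small_setU hL sD sE).
have DM : D `<=` M by move=> x Dx; apply: XM; left.
have EM : E `<=` M by move=> x Ex; apply: XM; right.
have siM : small K (ii M) by exact: small_image.
have siD : small K (ii D) by exact: small_image.
have siE : small K (ii E) by exact: small_image.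
pose e0 := emap i e; have ne0 : ~ acl (ii D) e0 by move=> /D0.
(* [tau] sends both [e0] and the [rho]-image of [g e] to [g e], viewed in [U0]; so these two points
   coincide, and [g e] lies in the orbit. *)
have key rho : automorphism rho -> fixes (ii D) rho ->
    ind0 (ii M) (ii D) (emap rho @` (ii M)) -> (emap rho @` (ii E)) e0.
  move=> arho frho ind.
  have [g [tau [ag fg at_ tg tr]]] :=
    conjugate_over_model tv clD DM sM D0 arho frho ind.
  have Ege : E (emap g e) by exists g.
  have Me : M e by apply: EM; exact: aut_orbit_refl.
  exists (emap i (emap g e)); first by exists (emap g e).
  apply: (@emap_inj _ _ _ tau); first by case: at_ => -[].
  by rewrite tr ?tg //; exact: EM.
(* The orbit of a non-algebraic [x] is not small, so some automorphism over [D] sends [x] outside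
   [E]; its inverse displaces [E] off [x]. *)
have /choice[G GP] (x : elt U0) : exists g : forall s, U0 s -> U0 s,
    [/\ automorphism g, fixes (ii D) g &
        ~ acl (ii D) x -> ~ (emap g @` (ii E)) x].
  apply: contrapT => ng; have fid := @fixes_id (ii D).
  have [ax|nx] := pselect (acl (ii D) x).
    by apply: ng; exists (fun _ y => y); split=> //; exact: aut_id.
  apply: nx; apply: (small_orbit_acl hL0 U0_monster siD).
  apply: small_sub siE => _ [h [ah fh ->]].
  have [g [ag hg gh]] := aut_inv ah.
  apply: contrapT => nE; apply: ng; exists g; split=> //.
    exact: fixes_inv fh gh.
  move=> _ [y Ey yx]; apply: nE; rewrite -yx.
  by case: y Ey {yx} => s y; rewrite /emap /= hg.
(* [W] must be fixed before [sig] exists. The summand [ii M] will force [sig] to send [e0] into [E],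
   so displacements off the points of [E] are enough. *)
pose W := ii M `|` \bigcup_(x in ii E) (emap (G x) @` (ii M)).
have sW : small K W.
  apply: (small_setU hL) => //; apply: (small_bigcup hL siE siM) => x _.
  exact: card_image_le.
have [M' [st indM']] := fe _ _ _ siM sW siD.
have [sig [asig fsig eM']] := same_type_aut hL0 U0_monster.2 siM siD st.
have sM' : small K M' by rewrite -eM'; exact: small_image.
have [rho [arho sr rs]] := aut_inv asig.
have frho : fixes (ii D) rho := fixes_inv fsig rs.
have inW g : automorphism g -> fixes (ii D) g -> emap g @` (ii M) `<=` W ->
    (emap g @` (ii E)) (emap sig e0).
  move=> ag fg gW; have sgM : small K (emap g @` (ii M)) by exact: small_image.
  have ind1 : ind0 M' (ii D) (emap g @` (ii M)) by exact: (mono_sub mono _ sW).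
  have [|y Ey ye] := key (fun s x => rho s (g s x)) (aut_comp arho ag) (fixes_comp frho fg).
    apply: (ind0_aut arho sM' siD sgM _ _ _ ind1).
    - by rewrite -eM'; exact: aut_image.
    - exact: emap_fix.
    - exact: emap_comp.
  exists y => //; rewrite -ye; case: y {Ey ye} => s y.
  by rewrite /emap /= sr.
have Ese : ii E (emap sig e0).
  have := inW _ (aut_id U0) (@fixes_id _); rewrite !emap_idE; apply.
  exact: subsetUl.
have nse : ~ acl (ii D) (emap sig e0).
  move=> ase; apply: ne0; rewrite -(aut_acl_fixes arho frho).
  by exists (emap sig e0) => //; rewrite /e0; case: (emap i e) => s x; rewrite /emap /= rs.
have [ag fg] := GP (emap sig e0); apply=> //; apply: inW => //.
by move=> y Gy; right; exists (emap sig e0).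
Qed.

(** Full existence over [B] and [C] together, followed by transitivity from [C] through that set;
    normality provides the nesting that transitivity demands. *)
Lemma ind0_extend A C B D : normality K ind0 -> transitivity K setT ind0 ->
  full_existence K ind0 -> small K A -> small K C -> small K B -> small K D ->
  ind0 A C B -> exists sig : forall s, U0 s -> U0 s,
    [/\ automorphism sig, fixes (B `|` C) sig &
      ind0 (emap sig @` A) C (D `|` (B `|` C))].
Proof.
move=> norm trans fe sA sC sB sD ind; have sBC := small_setU hL sB sC.
have [A' [st ind1]] := fe A D (B `|` C) sA sD sBC.
have [sig [asig fsig eA']] := same_type_aut hL0 U0_monster.2 sA sBC st.
have sA' : small K A' by rewrite -eA'; exact: small_image.
exists sig; split=> //; rewrite eA'.
have ind2 : ind0 A' C B.
  apply: (ind0_aut asig sA sC sB eA' _ _ ind); apply: emap_fix; apply: fixes_sub fsig.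
    exact: subsetUr.
  exact: subsetUl.
apply: (trans A' (B `|` C)) => //.
- exact: (small_setU hL).
- exact: norm.
- exact: norm.
Qed.

(** True of a conjugate of [A] over [B] and [C] by extension; moving back preserves the closure
    setwise. *)
Lemma ind0_acl A C B : normality K ind0 -> monotonicity K setT ind0 ->
  transitivity K setT ind0 ->
  full_existence K ind0 -> small K A -> small K C -> small K B ->
  ind0 A C B -> ind0 A C (acl (B `|` C)).
Proof.
move=> norm mono trans fe sA sC sB ind; have sBC := small_setU hL sB sC.
have sac := small_acl hL0 sBC.
have [sig [asig fsig ind1]] := ind0_extend norm trans fe sA sC sB sac ind.
have ind2 : ind0 (emap sig @` A) C (acl (B `|` C)).
  apply: (mono_sub mono _ _ sC I _ ind1); first exact: small_image.
    exact: (small_setU hL).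
  exact: subsetUl.
have [rho [arho sr rs]] := aut_inv asig.
have frho : fixes (B `|` C) rho := fixes_inv fsig rs.
apply: (ind0_aut arho _ sC sac _ _ _ ind2).
- exact: small_image.
- exact: aut_image.
- by apply: emap_fix; apply: fixes_sub frho; exact: subsetUr.
- exact: aut_acl_fixes.
Qed.

(** Base monotonicity of [ind0] changes the base to [E] but leaves [A1] on the left, where [F] is
    wanted. After symmetry, [ind0_acl] enlarges [A1] to the closure of [A1] and [E] in [U0], and
    [FD] shows that it contains [F]. *)
Lemma base_monotonicity_plus : normality K ind0 -> monotonicity K setT ind0 ->
  base_monotonicity K ind0 -> transitivity K setT ind0 -> symmetry K setT ind0 ->
  full_existence K ind0 -> base_monotonicity K (ind_plus ind0 Up).
Proof.
move=> norm mono bmono trans sym fe A B C D sA sB sC sD.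
rewrite /ind_plus -/i; set A1 := acl (A `|` C); set C1 := acl C.
have -> : B `|` D `|` C = B `|` (C `|` D) by rewrite -setUA (setUC D).
set B1 := acl (B `|` (C `|` D)) => ind.
set E := acl (C `|` D); set F := acl (A `|` (C `|` D)).
have sAC := small_setU hL sA sC; have sCD := small_setU hL sC sD.
have sBCD := small_setU hL sB sCD; have sACD := small_setU hL sA sCD.
have sA1 : small K A1 := small_acl hL sAC.
have sC1 : small K C1 := small_acl hL sC.
have sE : small K E := small_acl hL sCD.
have sB1 : small K B1 := small_acl hL sBCD.
have sF : small K F := small_acl hL sACD.
have [siA siC siE siB siF] : [/\ small K (ii A1), small K (ii C1), small K (ii E),
  small K (ii B1) & small K (ii F)] by split; exact: small_image.
have CA : C1 `<=` A1 by apply: acl_mono; exact: subsetUr.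
have CE : C1 `<=` E by apply: acl_mono; exact: subsetUl.
have EB : E `<=` B1 by apply: acl_mono; exact: subsetUr.
have ind1 : ind0 (ii A1) (ii E) (ii B1).
  have := bmono _ _ _ _ siA siB siC siE.
  rewrite -image_setU (setUidl EB) -image_setU (setUidr CE); exact.
have indE : ind0 (ii A1) (ii C1) (ii E).
  by apply: (mono_sub mono siA siB siC I _ ind); exact: image_subset.
have clA : closed_set A1 by exact: (acl_closed hL Up_monster).
have clC : closed_set C1 by exact: (acl_closed hL Up_monster).
have clE : closed_set E by exact: (acl_closed hL Up_monster).
pose X := acl (ii A1 `|` ii E) `&` dom Up.
have sAE := small_setU hL siA siE.
have clX : closed_set (M := U0) X.
  move=> f a Xa; split.
    by apply: (acl_closed hL0 U0_monster sAE) => s v; case: (Xa s v).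
  by apply: (dom_closed Up_U0) => s v; case: (Xa s v).
have indE' : ind0 (ii A1) (ii C1) (emap (fun s (x : U0 s) => x) @` (ii E)).
  by rewrite emap_idE.
(* [Up] is its own amalgam here and plays both roles in [common_substr]: all that is wanted is that
   [X] carries an L-substructure. *)
have am : @amalgam A1 E clA clE (fun s x => x) Up
    (@sub_incl _ _ _ _ clA) (@sub_incl _ _ _ _ clE).
  split=> //; [exact: UpT|split; exact: sub_incl_embedding].
have inX (Y : set (elt Up)) : ii Y `<=` ii A1 `|` ii E -> ii Y `<=` X.
  move=> Yo y Yy; split; first by apply: acl_ext; exact: Yo.
  by case: Yy => -[s x] _ <-; exact: (proj2_sig x).
have [|||||I [dI [h [hi eh]] _]] :=
  common_substr clC CA CE sA1 sC1 sE (acl0_closed_acl sC) (aut_id U0)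
    (@fixes_id _) indE' clX am am.
- by apply: inX; exact: subsetUl.
- by rewrite emap_idE; apply: inX; exact: subsetUr.
- by rewrite emap_idE => y [].
- by move=> y [].
- by move=> y [].
pose D' : set (elt Up) := [set e | X (emap i e)].
have clD' : closed_set D'.
  move=> f a Da; rewrite /D' /=.
  have Ia s v : dom I (existT U0 s (i (a s v))) by rewrite dI; exact: Da.
  pose b : tup I (fdom f) := fun s v => exist _ (i (a s v)) (Ia s v).
  have ea : a = tmap h b by apply: tup_ext => s v; apply: i_inj; rewrite /i hi.
  have [_ hf _] := eh; rewrite ea -hf /emap /= /i hi -dI.
  exact: (proj2_sig (ifn _ b)).
have sD' : small K D'.
  apply: small_le (small_acl hL0 sAE).
  apply: (@card_le_rel _ _ _ _ (fun x y => y = emap i x)).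
    by move=> x [Dx _]; exists (emap i x).
  by move=> x x' y _ _ -> /ii_inj.
have D'0 : acl0_closed D'.
  move=> e ae; split; last by case: e {ae} => s x; exact: (proj2_sig x).
  rewrite -(acl_idem hL0 U0_monster sAE); apply: acl_mono ae.
  by move=> _ [x [Dx _] <-].
have FD : F `<=` D'.
  apply: subset_trans (acl_of_acl0_closed mono fe clD' sD' D'0).
  apply: acl_mono => x Fx; apply: (inX [set x]); last by exists x.
  move=> _ [_ -> <-]; case: Fx => [Ax|CDx]; [left|right]; exists x => //.
    by apply: acl_ext; left.
  exact: acl_ext.
have ind2 : ind0 (ii B1) (ii E) (acl (ii A1 `|` ii E)).
  by apply: ind0_acl => //; exact: (sym _ _ _).
apply: (sym _ _ _) => //; apply: (mono_sub mono siB _ siE Logic.I _ ind2).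
  exact: (small_acl hL0).
by move=> _ [x /FD[Dx _] <-].
Qed.

(** The two classes of bases are linked only by the first hypothesis, so one proof serves all bases
    and models alike. *)
Lemma extension_plus (base : set (set (elt Up))) (base0 : set (set (elt U0))) :
  (forall C, small K C -> base C -> base0 (ii (acl C))) ->
  extension K base0 ind0 -> quantifier_elimination Tp ->
  extension K base (ind_plus ind0 Up).
Proof.
move=> bb ext qe A B C D sA sB sC sD bC.
rewrite /ind_plus -/i; set A1 := acl (A `|` C); set C1 := acl C.
set B1 := acl (B `|` C) => ind.
have -> : B `|` D `|` C = B `|` C `|` D by rewrite -setUA (setUC D) setUA.
set D1 := acl (B `|` C `|` D).
have sAC := small_setU hL sA sC; have sBC := small_setU hL sB sC.
have sBCD := small_setU hL sBC sD.
have sA1 : small K A1 := small_acl hL sAC.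
have sC1 : small K C1 := small_acl hL sC.
have sB1 : small K B1 := small_acl hL sBC.
have sD1 : small K D1 := small_acl hL sBCD.
have [siA siC siB siD] : [/\ small K (ii A1), small K (ii C1), small K (ii B1) &
  small K (ii D1)] by split; exact: small_image.
have CA : C1 `<=` A1 by apply: acl_mono; exact: subsetUr.
have CB : C1 `<=` B1 by apply: acl_mono; exact: subsetUr.
have BD : B1 `<=` D1 by apply: acl_mono; exact: subsetUl.
have [A' [st ind1]] := ext _ _ _ _ siA siB siC siD (bb C sC bC) ind.
have iCB : ii C1 `<=` ii B1 by exact: image_subset.
have iBD : ii B1 `<=` ii D1 by exact: image_subset.
move: st ind1; rewrite (setUidl iCB) (setUidr iBD) => st ind1.
have [sig [asig fsig eA']] := same_type_aut hL0 U0_monster.2 siA siB st.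
have sA' : small K A' by rewrite -eA'; exact: small_image.
have [rho [arho sr rs]] := aut_inv asig.
have frho : fixes (ii B1) rho := fixes_inv fsig rs.
have ind2 : ind0 (ii A1) (ii C1) (emap rho @` (ii D1)).
  apply: (ind0_aut arho sA' siC siD _ _ _ ind1) => //.
  - by rewrite -eA'; exact: aut_image.
  - by apply: emap_fix; exact: fixes_sub frho.
have clo (X : set (elt Up)) : small K X -> closed_set (acl X) by exact: (acl_closed hL Up_monster).
(* [ind2] provides the amalgam with the moved [D1]; the original [ind] lets uniqueness compare it
   with [Up] over [A1] and [B1]. *)
have [g [tau [ag fg at_ tg tr]]] := conjugate_qe qe (clo _ sAC) (clo _ sBC)
  (clo _ sC) (clo _ sBCD) CA CB BD sA1 sD1 (acl0_closed_acl sC) arho frho ind2 ind.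
have fgBC : fixes (B `|` C) g by apply: fixes_sub fg; exact: acl_ext.
exists (emap g @` A); split; first exact: aut_same_type.
have -> : acl (emap g @` A `|` C) = emap g @` A1.
  rewrite /A1 aut_acl // image_setU; congr (acl (_ `|` _)); symmetry.
  by apply: emap_fix; apply: fixes_sub fgBC; exact: subsetUr.
apply: (ind0_aut at_ siA siC _ _ _ _ ind2).
- by do 2 apply: small_image.
- by rewrite emap_comp [RHS]emap_comp; apply: emap_eq => e /tg.
- rewrite emap_comp; apply: emap_eq => e Ce; have := tg e (CA _ Ce).
  by rewrite (fg e (CB _ Ce)).
- by rewrite emap_comp emap_comp; apply: emap_eq => e /tr.
Qed.

Lemma aut_invariant_plus : aut_invariant K (ind_plus ind0 Up).
Proof.
move=> h ah A B C sA sB sC; rewrite /ind_plus -/i => ind.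
have sAC := small_acl hL (small_setU hL sA sC).
have sBC := small_acl hL (small_setU hL sB sC).
have sC1 := small_acl hL sC.
have [tau [atau tauh]] := aut_lift ah (small_setU hL (small_setU hL sAC sC1) sBC).
have E (X : set (elt Up)) : X `<=` acl (A `|` C) `|` acl C `|` acl (B `|` C) ->
    emap tau @` (ii X) = ii (emap h @` X).
  by move=> sub; rewrite emap_comp [RHS]emap_comp; apply: emap_eq => e /sub/tauh.
rewrite -!image_setU -!aut_acl //.
apply: (ind0_aut atau _ _ _ _ _ _ ind); try exact: small_image.
- by apply: E => e ?; left; left.
- by apply: E => e ?; left; right.
- by apply: E => e ?; right.
Qed.

Lemma normality_plus : normality K (ind_plus ind0 Up).
Proof. by move=> A B C _ _ _; rewrite /ind_plus -setUA setUid. Qed.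

(** * Properties relative to a class of bases *)

Section OverBases.
Context (base : set (set (elt Up))) (base0 : set (set (elt U0))).
Context (bb : forall C, small K C -> base C -> base0 (ii (acl C))).

Lemma monotonicity_plus :
  monotonicity K base0 ind0 -> monotonicity K base (ind_plus ind0 Up).
Proof.
move=> mono A B C D sA sB sC sD bC; rewrite /ind_plus -/i.
apply: (mono_sub mono _ _ _ (bb sC bC)).
- exact/small_image/(small_acl hL)/(small_setU hL).
- by apply/small_image/(small_acl hL)/(small_setU hL) => //; exact: (small_setU hL).
- exact/small_image/(small_acl hL).
- apply: image_subset; apply: acl_mono => e [Be|Ce]; [by left; left|by right].
Qed.

Lemma symmetry_plus : symmetry K base0 ind0 -> symmetry K base (ind_plus ind0 Up).
Proof.
move=> sym A B C sA sB sC bC; rewrite /ind_plus -/i.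
apply: (sym _ _ _); last exact: bb.
- exact/small_image/(small_acl hL)/(small_setU hL).
- exact/small_image/(small_acl hL)/(small_setU hL).
- exact/small_image/(small_acl hL).
Qed.

Lemma finite_sub_ii (X : set (elt U0)) (Y : set (elt Up)) :
  finite_set X -> X `<=` ii Y -> exists X', [/\ finite_set X', X' `<=` Y & X = ii X'].
Proof.
move=> fX XY; exists (emap i @^-1` X `&` Y); split.
- by apply: finite_setIl; apply: finite_preimage fX => x y _ _; exact: ii_inj.
- exact: subIsetr.
- apply/seteqP; split=> [x Xx|_ [x [Xx _] <-]//].
  by have [y Yy yx] := XY _ Xx; exists y => //; split=> //=; rewrite yx.
Qed.

(** A finite part of the closure of [A] and [C] is algebraic over [C] and finitely many points of
    [A]. The hypothesis applies to these points, and left monotonicity cuts their closure over [C]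
    down to the finite part. *)
Lemma finite_character_plus : finite_character K base0 ind0 ->
  left_monotonicity K base0 ind0 -> finite_character K base (ind_plus ind0 Up).
Proof.
move=> fc lm A B C sA sB sC bC; rewrite /ind_plus -/i => ind.
have siAC : small K (ii (acl (A `|` C))).
  exact/small_image/(small_acl hL)/(small_setU hL).
have siBC : small K (ii (acl (B `|` C))).
  exact/small_image/(small_acl hL)/(small_setU hL).
have siC : small K (ii (acl C)) by exact/small_image/(small_acl hL).
apply: fc => //; first exact: bb.
move=> X fX /(finite_sub_ii fX)[X' [fX' XAC ->]].
have [C0 [fC0 C0AC X'C0]] := acl_finite_set fX' XAC.
have fA0 : finite_set (C0 `&` A) by exact: finite_setIl.
have := ind _ fA0 (@subIsetr _ _ _).
have XA : ii X' `<=` ii (acl (C0 `&` A `|` C)).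
  apply: image_subset; apply: subset_trans X'C0 _; apply: acl_mono => e C0e.
  by have [Ae|Ce] := C0AC _ C0e; [left|right].
rewrite -(setUidr XA); apply: lm => //; last exact: bb.
- exact/small_image/(small_finite hL).
- apply/small_image/(small_acl hL)/(small_setU hL) => //; exact: (small_finite hL).
Qed.

(** The two left sides are closed over different bases; left monotonicity shrinks the second, closed
    over [B], to the first. *)
Lemma transitivity_plus : transitivity K base0 ind0 -> left_monotonicity K base0 ind0 ->
  transitivity K base (ind_plus ind0 Up).
Proof.
move=> trans lm A B C D sA sB sC sD bC bB CB BD; rewrite /ind_plus -/i.
rewrite (setUidl CB) (setUidl BD) (setUidl (subset_trans CB BD)) => ind1 ind2.
have si (X : set (elt Up)) : small K X -> small K (ii (acl X)).
  by move=> sX; exact/small_image/(small_acl hL).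
have sAC := small_setU hL sA sC; have sAB := small_setU hL sA sB.
have ind3 : ind0 (ii (acl (A `|` C))) (ii (acl B)) (ii (acl D)).
  apply: (lm _ _ _ (ii (acl (A `|` B)))); [exact: si|exact: si|exact: si|exact: si|exact: bb|].
  have sub : ii (acl (A `|` C)) `<=` ii (acl (A `|` B)).
    apply: image_subset; apply: acl_mono.
    by move=> e [Ae|/CB Be]; [left|right].
  by rewrite (setUidr sub).
apply: (trans _ (ii (acl B))) ind1 ind3; try exact: si; try exact: bb.
  by apply: image_subset; exact: acl_mono.
by apply: image_subset; exact: acl_mono.
Qed.

End OverBases.

(** Model completeness makes the submodel elementary in [Up], hence equal to its algebraic
    closure. *)
Lemma submodel_acl C : subtheory T0 Tp -> submodel Tp C -> submodel T0 (ii (acl C)).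
Proof.
move=> sT [N [sN dN NTp]].
have [mc _ _] := Tp_mc.
have elem : elementary_on setT (@Defs.incl S L Up N) by exact: mc.
have dNE : emap (@Defs.incl S L Up N) @` setT = C.
  rewrite -dN; apply/seteqP; split=> [_ [[s x] _ <-]|[s x] Nx]; first exact: (proj2_sig x).
  by exists (existT N s (exist _ x Nx)).
have aclC : acl C = C.
  apply/seteqP; split; last exact: acl_ext.
  by apply: tv_closed_acl; rewrite -dNE; exact: elementary_tv_closed.
have ej := @embedding_comp S L0 (lred L0 N) (lred L0 Up) U0 _ i
  (embedding_lred _ sN) i_embedding.
have [N' [k [ek sk _ dN' rN']]] := image_lred ej.
exists (reduct L0 N'); split=> //.
  by rewrite aclC -dNE emap_comp.
exact: (@models_lred S L L0 N' T0 Tp sT (iso_models ek sk NTp)).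
Qed.

(** * Local character *)

(** Indexing types by sets of L-formulas is what allows the hypothesis on the
    cofinality to be used. *)
Definition type_code G (a : tup U0 G) : set (any_formula L) :=
  [set q | exists p : formula L0 G, q = existT _ G (lift_formula p) /\ sat p a].

Lemma type_code_aut G (a : tup U0 G) G' (a' : tup U0 G') :
  type_code a = type_code a' -> exists sig : forall s, U0 s -> U0 s,
    automorphism sig /\ emap sig @` range_tup a = range_tup a'.
Proof.
move=> e.
have eG : G = G'.
  have : type_code a (existT _ G (lift_formula (FTrue L0 G)))
    by exists (FTrue L0 G); split=> //; exact: id.
  by rewrite e => -[p [/(f_equal (@projT1 _ _))]].
move: a' e; rewrite -eG => {G' eG} a' e.
have aa' (p : formula L0 G) : sat p a -> sat p a'.
  move=> pa; have : type_code a (existT _ G (lift_formula p)) by exists p.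
  by rewrite e => -[q [e0 qa]]; rewrite (lift_formula_inj (existT_inj e0)).
pose R : set (elt (pairs U0 U0)) :=
  range_tup ((fun s v => (a s v, a' s v)) : tup (pairs U0 U0) G).
have Ren G1 (w : tup (pairs U0 U0) G1) : tup_in R w ->
    exists r : renaming G1 G, w = precomp r (fun s v => (a s v, a' s v)).
  move=> Rw; have P s (v : var G1 s) : exists u : var G s, w s v = (a s u, a' s u).
    have key z : R z -> exists u : var G (projT1 z), projT2 z = (a _ u, a' _ u).
      by move=> [t [u ->]]; exists u.
    exact: key (Rw s v).
  exists (fun s v => projT1 (cid (P s v))); apply: tup_ext => s v.
  by rewrite /precomp; case: cid.
have pR : @pelem S L0 U0 U0 R.
  apply: pelem_half => G1 p w /Ren[r ->].
  rewrite -[X in sat _ X -> _]/(precomp r a) -[X in _ -> sat _ X]/(precomp r a').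
  by move=> pa; apply/sat_ren/aa'/sat_ren.
have [|sig [asig sigR]] := pelem_aut U0_monster.2 pR.
  by apply: small_image; apply: (small_finite hL); exact: finite_range_tup.
have sa s (v : var G s) : sig s (a s v) = a' s v by apply: sigR; exists s, v.
exists sig; split=> //; apply/seteqP; split=> [_ [_ [s [v ->]] <-]|_ [s [v ->]]].
  by exists s, v; rewrite /emap /= sa.
by exists (existT U0 s (a s v)); [exists s, v|rewrite /emap /= sa].
Qed.

(** By invariance, a bound for one tuple serves all tuples of its type; the bounds are thus indexed
    by sets of formulas, and the cofinality clause gives a common one. *)
Lemma finite_local_bound : large_cardinal K L -> local_character K ind0 ->
  exists Z0 : set K, small K Z0 /\ forall X, finite_set X -> forall B, small K B ->
    exists C, [/\ C `<=` B, C #<= Z0 & ind0 X C B].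
Proof.
move=> [_ _ cof] lc.
have /choice[F FP] (c : set (any_formula L)) : exists Z : set K, small K Z /\
    forall G (a : tup U0 G), type_code a = c -> forall B, small K B ->
      exists C, [/\ C `<=` B, card_lt C Z & ind0 (range_tup a) C B].
  have [[G [a ac]]|no] := pselect (exists G (a : tup U0 G), type_code a = c); last first.
    (* A code realised by no tuple receives an arbitrary bound. *)
    exists set0; split; first exact/(small_finite hL)/finite_set0.
    by move=> G a ac; case: no; exists G, a.
  have sa := small_finite hL (finite_range_tup a).
  have [Z [sZ ZP]] := lc _ sa; exists Z; split=> // G' a' a'c B sB.
  have [sig [asig <-]] : exists sig : forall s, U0 s -> U0 s,
      automorphism sig /\ emap sig @` range_tup a = range_tup a'.
    by apply: type_code_aut; rewrite ac a'c.
  have [rho [arho sr rs]] := aut_inv asig.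
  have srB : small K (emap rho @` B) by exact: small_image.
  have [C [CB CZ ind]] := ZP _ srB.
  exists (emap sig @` C); split.
  - by rewrite -(aut_image B sr); exact: image_subset.
  - by apply: contra CZ => /card_le_trans; apply; exact: card_image_le.
  - apply: (ind0_aut asig sa _ srB _ _ _ ind) => //; first exact: small_sub srB.
    exact: aut_image.
have [|Z0 [sZ0 Z0P]] := cof F; first by move=> c; case: (FP c).
exists Z0; split=> // X /finite_is_range[G [a ->]] B sB.
have [_ /(_ G a erefl B sB)[C [CB CZ ind]]] := FP (type_code a).
exists C; split=> //; apply: card_le_trans (Z0P (type_code a)).
by have [//|ZC] := card_le_total C (F (type_code a)); move: CZ; rewrite /card_lt ZC.
Qed.

Lemma local_character_plus : large_cardinal K L -> base_monotonicity K ind0 ->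
  finite_character K setT ind0 -> local_character K ind0 ->
  local_character K (ind_plus ind0 Up).
Proof.
move=> lcK bm fc lc A sA.
have [ZF [sZF ZFP]] := finite_local_bound lcK lc.
have [Z0 [iZ0 sZ0 LZ0 AZ0 FZ0]] := small_bound hL sA sZF.
(* Local character asks for a strict inequality; the limit clause supplies a small set larger than
   [Z0]. *)
have [_ lim _] := lcK; have [Z [sZ Z0Z]] := lim _ sZ0.
exists Z; split=> // B sB.
have sacl := small_acl hL sB; have siB : small K (ii (acl B)) by exact: small_image.
have /choice[supp suppP] (c : elt Up) : exists C0, acl B c ->
    [/\ finite_set C0, C0 `<=` B & acl C0 c].
  have [Bc|nBc] := pselect (acl B c); last by exists set0.
  by have [C0 ?] := acl_finite Bc; exists C0.
(* [P l] gathers supports in [B] for a base in [acl B] over which [l] is independent. Any larger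
   subset of [B] has that base in its closure, and base monotonicity applies. Lists stand for finite
   sets because they can be counted. *)
have /choice[P PP] (l : seq (elt Up)) : exists P : set (elt Up),
    [/\ P `<=` B, P #<= Z0 & forall Q, P `<=` Q -> Q `<=` B ->
      ind0 (ii [set x | List.In x l]) (ii (acl Q)) (ii (acl B))].
  have fl : finite_set [set x | List.In x l].
    elim: l => [|x l IH] /=; first exact: sub_finite_set (@finite_set0 _).
    apply: sub_finite_set (_ : finite_set (x |` [set y | List.In y l])).
      by move=> y [<-|?]; [left|right].
    by rewrite finite_setU; split=> //; exact: finite_set1.
  have [C' [C'B C'Z ind]] := ZFP _ (finite_image (emap i) fl) _ siB.
  pose C := emap i @^-1` C' `&` acl B.
  have C'E : C' = ii C.
    apply/seteqP; split=> [x Cx|_ [x [Cx _] <-]//].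
    by have [y By yx] := C'B _ Cx; exists y => //; split=> //=; rewrite yx.
  exists (\bigcup_(c in C) supp c); split.
  - by move=> x [c [_ Bc] cx]; have [_ sub _] := suppP _ Bc; exact: sub.
  - apply: (card_bigcup_le iZ0).
      apply: card_le_trans (card_le_trans C'Z FZ0).
      apply: (@card_le_rel _ _ _ _ (fun x y => y = emap i x)).
        by move=> x [Cx _]; exists (emap i x).
      by move=> x x' y _ _ -> /ii_inj.
    by move=> c [_ Bc]; have [fs _ _] := suppP _ Bc; exact: card_finite_le.
  - move=> Q PQ QB.
    have CQ : ii C `<=` ii (acl Q).
      apply: image_subset => c Cc; have [_ Bc] := Cc; have [_ _ ac] := suppP _ Bc.
      by apply: acl_mono ac; apply: subset_trans PQ => x cx; exists c.
    have QB' : ii (acl Q) `<=` ii (acl B) by apply: image_subset; exact: acl_mono.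
    rewrite -(setUidr CQ); apply: bm => //.
    + exact/small_image/(small_finite hL).
    + by rewrite -C'E; exact: small_sub siB.
    + exact: small_sub siB.
    + by rewrite (setUidl QB') -C'E.
(* A finite subset of the final closure lies in the closure of some stage, and its supports enter at
   the following one. *)
pose next Q := Q `|` \bigcup_(l in [set l | List.Forall (acl (A `|` Q)) l]) P l.
pose Q_ n := iter n next set0.
have Q_B n : Q_ n `<=` B.
  elim: n => //= n IH; rewrite subUset; split=> // x [l _ Px].
  by have [sub _ _] := PP l; exact: sub.
have Q_Z n : Q_ n #<= Z0.
  elim: n => [|n IH] /=; first exact: card_ge0.
  apply: (card_setU_le iZ0) => //; apply: (card_bigcup_le iZ0) => [|l _].
    apply: (card_seq_le iZ0); apply: (card_acl_le iZ0 LZ0).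
    exact: (card_setU_le iZ0).
  by have [] := PP l.
pose Q := \bigcup_n Q_ n.
have QB : Q `<=` B by move=> x [n _]; exact: Q_B.
have QZ : Q #<= Z0 by apply: (card_bigcup_le iZ0) => // ; exact: card_nat_le.
exists Q; split=> //; first by apply: contra Z0Z => /card_le_trans; apply.
rewrite /ind_plus -/i (setUidl QB).
have sQ := small_sub QB sB.
apply: fc => //; try exact/small_image/(small_acl hL)/(small_setU hL).
  exact/small_image/(small_acl hL).
move=> X fX /(finite_sub_ii fX)[X' [fX' XAQ ->]].
have [C0 [fC0 C0AQ XC0]] := acl_finite_set fX' XAQ.
have [G [c eC0]] := finite_is_range fC0.
have [||n An] := @tup_in_bigcup _ _ Up (fun n => A `|` Q_ n) _ G c _.
- by move=> n x [Ax|Qx]; [left|right; left].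
- apply/range_tup_sub; rewrite -eC0 => x /C0AQ[Ax|[n _ Qx]].
    by exists 0 => //; left.
  by exists n => //; right.
have [l lX] := finite_set_list fX'; rewrite lX.
have [_ _] := PP l; apply=> //.
move=> x Px; exists n.+1 => //; right; exists l => //=.
apply/List.Forall_forall => y yl; apply: acl_mono (XC0 y _); last by rewrite lX.
by rewrite eC0; apply/range_tup_sub.
Qed.

End Amalgam.

Unset Implicit Arguments.

Theorem theorem3p12 (S : Type) (L : language S) (L0 : sublanguage L)
  (K : Type) (hK : large_cardinal K L)
  (T0 : theory L0) (T Tp Tc : theory L)
  (hT0 : deductively_closed T0) (hT : deductively_closed T)
  (hTp : deductively_closed Tp) (hTc : deductively_closed Tc)
  (* the theory T0, its monster model, and the relation on it *)
  (T0_complete : complete T0) (T0_mc : model_complete T0)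
  (T0_qe : quantifier_elimination T0)
  (U0 : structure L0) (U0_model : models U0 T0) (U0_monster : monster K U0)
  (ind0 : ternary U0) (ind0_inv : aut_invariant K ind0)
  (* the theory T and its model companion *)
  (T0_T : subtheory (univ_part T0) T)
  (T_dl : derivation_like K ind0 T)
  (T_Tp : T `<=` Tp) (Tp_mc : model_companion T Tp)
  (* the monster model of a completion of the model companion *)
  (Tp_Tc : Tp `<=` Tc) (Tc_complete : complete Tc)
  (Up : structure_in L U0) (Up_model : models Up Tc) (Up_monster : monster K Up)
  (Up_U0 : substr_of (reduct L0 Up)) :
  let indp := ind_plus ind0 Up in
  (* (1) *)
  (aut_invariant K indp /\ normality K indp) /\
  (* (2) *)
  [/\ monotonicity K setT ind0 -> monotonicity K setT indp,
      symmetry K setT ind0 -> symmetry K setT indp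
    & finite_character K setT ind0 -> left_monotonicity K setT ind0 ->
      finite_character K setT indp] /\
  (* (3) *)
  (transitivity K setT ind0 -> monotonicity K setT ind0 ->
   left_monotonicity K setT ind0 -> transitivity K setT indp) /\
  (* (4) *)
  (base_monotonicity K ind0 -> finite_character K setT ind0 ->
   local_character K ind0 -> local_character K indp) /\
  (* (5) *)
  (normality K ind0 -> monotonicity K setT ind0 -> base_monotonicity K ind0 ->
   transitivity K setT ind0 -> symmetry K setT ind0 ->
   full_existence K ind0 -> base_monotonicity K indp) /\
  (* (6) *)
  (monotonicity K setT ind0 -> symmetry K setT ind0 ->
   full_existence K ind0 -> full_existence K indp) /\
  (* (7) *)
  (monotonicity K setT ind0 -> extension K setT ind0 ->
   quantifier_elimination Tp -> extension K setT indp) /\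
  (* (2), (3) and (7) over models *)
  (subtheory T0 Tp ->
   let mod0 := submodel T0 : set (set (elt U0)) in
   let modp := submodel Tp : set (set (elt Up)) in
   [/\ monotonicity K mod0 ind0 -> monotonicity K modp indp,
       symmetry K mod0 ind0 -> symmetry K modp indp
     & finite_character K mod0 ind0 -> left_monotonicity K mod0 ind0 ->
       finite_character K modp indp] /\
   (transitivity K mod0 ind0 -> monotonicity K mod0 ind0 ->
    left_monotonicity K mod0 ind0 -> transitivity K modp indp) /\
   (monotonicity K mod0 ind0 -> extension K mod0 ind0 ->
    quantifier_elimination Tp -> extension K modp indp)).
Proof.
(* The size hypothesis concerns sets of formulas; singletons bring it down to formulas. *)
have hL : small K [set: any_formula L].
  have [sK _ _] := hK; apply: small_le sK.
  apply: (@card_le_rel _ _ _ _ (fun x y => y = [set x])).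
    by move=> x _; exists [set x].
  by move=> x x' y _ _ -> e; have : [set x'] x by rewrite -e.
have hL0 := @small_sub_formulas S L L0 K hL.
have UpTp : models Up Tp by move=> p /Tp_Tc; exact: Up_model.
move=> indp.
have ext base base0 := @extension_plus S L L0 K hL hL0 T0 T Tp T0_qe U0 U0_model
  U0_monster ind0 T_dl T_Tp Tp_mc Up UpTp Up_monster Up_U0 ind0_inv base base0.
split; [|split; [|split; [|split; [|split; [|split; [|split]]]]]].
- split; last exact: normality_plus.
  exact: (aut_invariant_plus hL T0_qe U0_model U0_monster Up_U0 ind0_inv).
- split; [exact: (monotonicity_plus hL)|exact: (symmetry_plus hL)|].
  exact: (finite_character_plus hL).
- by move=> trans _; exact: (transitivity_plus hL _ trans).
- exact: (local_character_plus hL U0_monster ind0_inv hK).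
- exact: (base_monotonicity_plus hL hL0 T0_qe U0_model U0_monster T_dl T_Tp Tp_mc
    UpTp Up_monster Up_U0 ind0_inv).
- exact: (full_existence_plus hL hL0 T0_qe U0_model U0_monster T_dl T_Tp Tp_mc
    UpTp Up_monster Up_U0 ind0_inv).
- by move=> _; exact: ext.
move=> sT mod0 modp.
have bb C : small K C -> modp C -> mod0 (emap (@Defs.incl S L U0 Up) @` acl C).
  by move=> _; exact: (submodel_acl Tp_mc UpTp Up_U0 sT).
split; [|split].
- split; [exact: (monotonicity_plus hL bb)|exact: (symmetry_plus hL bb)|].
  exact: (finite_character_plus hL bb).
- by move=> trans _; exact: (transitivity_plus hL bb trans).
- by move=> _; exact: (ext _ _ bb).
Qed.
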